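(* Let $A$ be a finitely generated $n$-rigid group and $m \geq 1$. Then: 1) if $P \subsetneq S$ are non-empty irreducible algebraic sets in $A^m$, then $\alpha(S) > \alpha(P)$ in the left lexicographical order; 2) the Krull dimension of any irreducible algebraic set in $A^m$ does not exceed $(m+1)^n$. In particular, the Krull dimension of $A^m$ is finite for every $m$.
   Context: **Algebraic sets.** Let $A$ be a group, $X = \{x_1,\ldots,x_m\}$, $F(X)$ the free group on $X$, and $A[X] = A * F(X)$. For $s \in A[X]$ and $(a_1,\ldots,a_m)\in A^m$, $s(a_1,\ldots,a_m)\in A$ is obtained by replacing each $x_j$ by $a_j$. For $T \subseteq A[X]$ put $V_A(T) = \{a \in A^m \mid s(a) = 1 \text{ for all } s\in T\}$; such sets are the algebraic subsets of $A^m$. The Zariski topology on $A^m$ is the topology having the algebraic sets as a pre-basis (subbasis) of closed sets. A (non-empty) closed subset is irreducible if it is not a union of two closed proper subsets. For an algebraic set $Y\subseteq A^m$, $I(Y) = \{f\in A[X] \mid f(a)=1 \text{ for all } a \in Y\}$ and $\Gamma(Y) = A[X]/I(Y)$ is the coordinate group of $Y$. If $Y \ne\emptyset$ then $A$ embeds canonically into $\Gamma(Y)$. **Krull dimension.** An $A$-group is a group with a distinguished subgroup identified with $A$; an $A$-homomorphism is a homomorphism of $A$-groups that is the identity on $A$. An $A$-group $H$ is $A$-discriminated by $A$ if for every finite $K\subseteq H$ there is an $A$-homomorphism $H\to A$ injective on $K$. A prime ideal of an $A$-group $H$ is a normal subgroup $N$ of $H$ with $N\cap A=1$ such that $H/N$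 is $A$-discriminated by $A$. The Krull dimension $Kdim_A(H)$ is the supremum of the $k$ for which there is a chain $p_0\subset p_1\subset\cdots\subset p_k$ of distinct prime ideals of $H$. The Krull dimension of a non-empty algebraic set $Y$ is $Kdim_A(\Gamma(Y))$; since finitely generated rigid groups are equationally Noetherian, this equals the Zariski dimension of $Y$, i.e. the supremum of the $k$ for which there is a chain $Z_0\subset\cdots\subset Z_k$ of distinct non-empty irreducible closed subsets of $Y$. **Rigid groups.** A right $R$-module $T$ has no torsion if $xr=0$ ($x\in T$, $r\in R$) implies $x=0$ or $r=0$. A principal series of a group $G$ is a series of normal subgroups of $G$, $G = G_1 > G_2 > \cdots > G_n > G_{n+1} = 1$, such that each factor $G_i/G_{i+1}$ is abelian and has no torsion as a right $\mathbb{Z}[G/G_i]$-module (action by conjugation), $i=1,\ldots,n$. A group with a principal series is called rigid; the series is unique and $n$ is the solvability class of $G$. A rigid group of solvability class $n$ is called $n$-rigid. The ring $R_i(G)=\mathbb{Z}[G/G_i]$ is an Ore domain, and for a torsion-free right module over an Ore domain the rank is the cardinality of a maximal linearly independent set. Put $r_i(G) = \operatorname{rank}_{R_i(G)} (G_i/G_{i+1})$ and $r(G)=(r_1(G),\ldots,r_n(G))$. **The function $\alpha$.** For a non-empty irreducible algebraic set $S\subseteq A^m$ ($A$ a finitely generated $n$-rigid group), the coordinate group $\Gamma(S)$ is $n$-rigid, and $\alpha(S) = r(\Gamma(S)) - r(A)$ (componentwise difference of $n$-tuples). *)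

(* Defs.v *)
From HB Require Import structures.
From mathcomp Require Import all_boot all_order all_algebra finmap.
From mathcomp Require Import all_classical constructive_ereal topology_structure.

Set Implicit Arguments.
Unset Strict Implicit.
Unset Printing Implicit Defensive.

Local Open Scope quotient_scope.
Local Open Scope classical_set_scope.
Local Open Scope group_scope.

Notation "{ 'hom' G -> H }" := (monoid.UMagmaMorphism.type G H)
  (at level 0, G at level 98, H at level 99, format "{ 'hom'  G  ->  H }") :
  type_scope.

Lemma morphM_monoid (G H : groupType) (f : G -> H) :
  {morph f : x y / x * y} -> monoid.monoid_morphism f.
Proof.
by move=> fM; split=> //; apply: (mulgI (f 1)); rewrite -fM !mulg1.
Qed.

Definition is_subgroup (G : groupType) (S : set G) : Prop :=
  S 1 /\ forall x y, S x -> S y -> S (x / y).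

Definition finitely_generated (G : groupType) : Prop :=
  exists s : seq G, forall S : set G,
    is_subgroup S -> (forall x, x \in s -> S x) -> S = setT.

Record normalSubgroup (G : groupType) := NormalSubgroup {
  nsub_set :> G -> Prop;
  nsub_subgroup : is_subgroup nsub_set;
  nsub_conj : forall x g, nsub_set x -> nsub_set (x ^ g)
}.

Section QuotientGroup.
Variables (G : groupType) (N : normalSubgroup G).

Lemma nsub1 : N 1. Proof. exact: (nsub_subgroup N).1. Qed.

Lemma nsubF x y : N x -> N y -> N (x / y).
Proof. exact: (nsub_subgroup N).2. Qed.

Lemma nsubV x : N x -> N x^-1.
Proof. by move=> Nx; rewrite -[x^-1]mul1g; apply: nsubF => //; exact: nsub1. Qed.

Lemma nsubM x y : N x -> N y -> N (x * y).
Proof. by move=> Nx Ny; rewrite -[y]invgK; apply: nsubF => //; exact: nsubV. Qed.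

Definition coset_rel (x y : G) : bool := `[< N (x^-1 * y) >].

Lemma coset_rel_refl : reflexive coset_rel.
Proof. by move=> x; apply/asboolP; rewrite mulVg; exact: nsub1. Qed.

Lemma coset_rel_sym : symmetric coset_rel.
Proof.
have S x y : coset_rel x y -> coset_rel y x.
  by move=> /asboolP/nsubV; rewrite invgM invgK => ?; apply/asboolP.
by move=> x y; apply/idP/idP; exact: S.
Qed.

Lemma coset_rel_trans : transitive coset_rel.
Proof.
move=> y x z /asboolP Nxy /asboolP Nyz; apply/asboolP.
by have := nsubM Nxy Nyz; rewrite -mulgA mulVKg.
Qed.

Canonical coset_equiv :=
  EquivRel coset_rel coset_rel_refl coset_rel_sym coset_rel_trans.

Definition quotientGroup := {eq_quot coset_rel}.
HB.instance Definition _ := Choice.on quotientGroup.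
HB.instance Definition _ := EqQuotient.on quotientGroup.

Definition coset_pi (x : G) : quotientGroup := \pi x.

Lemma coset_piP x y : coset_pi x = coset_pi y <-> N (x^-1 * y).
Proof. by split=> [/eqmodP/asboolP|h]; last by apply/eqmodP/asboolP. Qed.

Let reprP (x : quotientGroup) : coset_pi (repr x) = x. Proof. exact: reprK. Qed.

Let qone := coset_pi 1.
Let qmul (x y : quotientGroup) := coset_pi (repr x * repr y).
Let qinv (x : quotientGroup) := coset_pi (repr x)^-1.

Let qmulE x y : qmul (coset_pi x) (coset_pi y) = coset_pi (x * y).
Proof.
have /coset_piP Nx := reprP (coset_pi x).
have /coset_piP Ny := reprP (coset_pi y).
apply/coset_piP; rewrite invgM -mulgA [_ * (x * y)]mulgA.
have -> : (repr (coset_pi y))^-1 * ((repr (coset_pi x))^-1 * x * y) =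
   ((repr (coset_pi y))^-1 * y) * (((repr (coset_pi x))^-1 * x) ^ y).
  by rewrite conjgE !mulgA mulgK.
by apply: nsubM => //; exact: nsub_conj.
Qed.

Let qinvE x : qinv (coset_pi x) = coset_pi x^-1.
Proof.
have /coset_piP/nsubV Nx := reprP (coset_pi x).
apply/coset_piP; rewrite invgK.
have := nsub_conj x^-1 Nx.
by rewrite conjgE invgM !invgK !mulgA mulgV mul1g.
Qed.

Let qmulA : associative qmul.
Proof.
move=> x y z; rewrite -(reprP x) -(reprP y) -(reprP z).
by rewrite !qmulE mulgA.
Qed.
Let qmul1g : left_id qone qmul.
Proof. by move=> x; rewrite -(reprP x) qmulE mul1g. Qed.
Let qmulg1 : right_id qone qmul.
Proof. by move=> x; rewrite -(reprP x) qmulE mulg1. Qed.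
Let qmulVg : left_inverse qone qinv qmul.
Proof. by move=> x; rewrite -(reprP x) qinvE qmulE mulVg. Qed.
Let qmulgV : right_inverse qone qinv qmul.
Proof. by move=> x; rewrite -(reprP x) qinvE qmulE mulgV. Qed.

HB.instance Definition _ :=
  isGroup.Build quotientGroup qmulA qmul1g qmulg1 qmulVg qmulgV.

Lemma coset_piM : {morph coset_pi : x y / x * y}.
Proof. by move=> x y; rewrite -qmulE. Qed.
HB.instance Definition _ :=
  monoid.isUMagmaMorphism.Build _ _ coset_pi (morphM_monoid coset_piM).

End QuotientGroup.

Inductive gexpr (A : Type) (m : nat) : Type :=
| GConst of A
| GVar of 'I_m
| GOne
| GMul of gexpr A m & gexpr A m
| GInv of gexpr A m.
Arguments GVar {A m}.
Arguments GOne {A m}.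
Arguments GConst {A m}.

HB.instance Definition _ (A : Type) m := gen_eqMixin (gexpr A m).
HB.instance Definition _ (A : Type) m := gen_choiceMixin (gexpr A m).

(* A * F(X) is the group generated by A and X subject to the multiplication
   table of A only: gexpr_eq is the congruence generated by the group laws and
   that table. *)
Inductive gexpr_eq (A : groupType) (m : nat) : gexpr A m -> gexpr A m -> Prop :=
| gexpr_refl s : gexpr_eq s s
| gexpr_sym s t : gexpr_eq s t -> gexpr_eq t s
| gexpr_trans s t u : gexpr_eq s t -> gexpr_eq t u -> gexpr_eq s u
| gexpr_mul s s' t t' :
    gexpr_eq s s' -> gexpr_eq t t' -> gexpr_eq (GMul s t) (GMul s' t')
| gexpr_inv s s' : gexpr_eq s s' -> gexpr_eq (GInv s) (GInv s')
| gexpr_mulA s t u : gexpr_eq (GMul s (GMul t u)) (GMul (GMul s t) u)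
| gexpr_mul1g s : gexpr_eq (GMul GOne s) s
| gexpr_mulg1 s : gexpr_eq (GMul s GOne) s
| gexpr_mulVg s : gexpr_eq (GMul (GInv s) s) GOne
| gexpr_mulgV s : gexpr_eq (GMul s (GInv s)) GOne
| gexpr_const a b : gexpr_eq (GMul (GConst a) (GConst b)) (GConst (a * b)).

Section FreeAGroup.
Variables (A : groupType) (m : nat).
Local Notation E := (gexpr A m).

Definition gexpr_rel (s t : E) : bool := `[< gexpr_eq s t >].

Lemma gexpr_rel_refl : reflexive gexpr_rel.
Proof. by move=> s; apply/asboolP; exact: gexpr_refl. Qed.
Lemma gexpr_rel_sym : symmetric gexpr_rel.
Proof.
by move=> s t; apply/idP/idP => /asboolP ?; apply/asboolP; exact: gexpr_sym.
Qed.
Lemma gexpr_rel_trans : transitive gexpr_rel.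
Proof.
by move=> t s u /asboolP ? /asboolP ?; apply/asboolP; exact: (@gexpr_trans _ _ _ t).
Qed.

Canonical gexpr_equiv :=
  EquivRel gexpr_rel gexpr_rel_refl gexpr_rel_sym gexpr_rel_trans.

Definition freeAGroup := {eq_quot gexpr_rel}.
HB.instance Definition _ := Choice.on freeAGroup.
HB.instance Definition _ := EqQuotient.on freeAGroup.

Definition gexpr_class (s : E) : freeAGroup := \pi s.
Local Notation cl := gexpr_class.
Let clP s t : cl s = cl t <-> gexpr_eq s t.
Proof. by split=> [/eqmodP/asboolP|h]; last by apply/eqmodP/asboolP. Qed.
Let clK x : cl (repr x) = x. Proof. exact: reprK. Qed.
Let cl_repr s : gexpr_eq (repr (cl s)) s. Proof. by apply/clP; rewrite clK. Qed.

Let fmul (x y : freeAGroup) := cl (GMul (repr x) (repr y)).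
Let finv (x : freeAGroup) := cl (GInv (repr x)).

Let fmulE s t : fmul (cl s) (cl t) = cl (GMul s t).
Proof. by apply/clP; apply: gexpr_mul; exact: cl_repr. Qed.
Let finvE s : finv (cl s) = cl (GInv s).
Proof. by apply/clP; apply: gexpr_inv; exact: cl_repr. Qed.

Let fmulA : associative fmul.
Proof.
move=> x y z; rewrite -(clK x) -(clK y) -(clK z) !fmulE; apply/clP.
exact: gexpr_mulA.
Qed.
Let fmul1g : left_id (cl GOne) fmul.
Proof. by move=> x; rewrite -(clK x) fmulE; apply/clP; exact: gexpr_mul1g. Qed.
Let fmulg1 : right_id (cl GOne) fmul.
Proof. by move=> x; rewrite -(clK x) fmulE; apply/clP; exact: gexpr_mulg1. Qed.
Let fmulVg : left_inverse (cl GOne) finv fmul.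
Proof.
by move=> x; rewrite -(clK x) finvE fmulE; apply/clP; exact: gexpr_mulVg.
Qed.
Let fmulgV : right_inverse (cl GOne) finv fmul.
Proof.
by move=> x; rewrite -(clK x) finvE fmulE; apply/clP; exact: gexpr_mulgV.
Qed.

HB.instance Definition _ :=
  isGroup.Build freeAGroup fmulA fmul1g fmulg1 fmulVg fmulgV.

Definition freeA_const (a : A) : freeAGroup := cl (GConst a).
Definition freeA_var (i : 'I_m) : freeAGroup := cl (GVar i).

Lemma freeA_constM : {morph freeA_const : a b / a * b}.
Proof. by move=> a b; rewrite -[RHS]/(fmul (cl _) (cl _)) fmulE; apply/esym/clP; exact: gexpr_const. Qed.
HB.instance Definition _ :=
  monoid.isUMagmaMorphism.Build _ _ freeA_const (morphM_monoid freeA_constM).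

(* The homomorphism A[X] -> H extending f : A -> H and x_i |-> h i. *)
Section Lift.
Variables (H : groupType) (f : {hom A -> H}) (h : 'I_m -> H).

Fixpoint gexpr_eval (s : E) : H :=
  match s with
  | GConst a => f a
  | GVar i => h i
  | GOne => 1
  | GMul s t => gexpr_eval s * gexpr_eval t
  | GInv s => (gexpr_eval s)^-1
  end.

Lemma gexpr_eq_eval s t : gexpr_eq s t -> gexpr_eval s = gexpr_eval t.
Proof.
elim=> //=.
- by move=> ? ? ? _ -> _ ->.
- by move=> ? ? ? ? _ -> _ ->.
- by move=> ? ? _ ->.
- by move=> *; rewrite mulgA.
- by move=> *; rewrite mul1g.
- by move=> *; rewrite mulg1.
- by move=> *; rewrite mulVg.
- by move=> *; rewrite mulgV.
- by move=> *; rewrite gmulfM.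
Qed.

Definition freeA_lift (x : freeAGroup) : H := gexpr_eval (repr x).

Let liftE s : freeA_lift (cl s) = gexpr_eval s.
Proof. exact/gexpr_eq_eval/cl_repr. Qed.

Lemma freeA_liftM : {morph freeA_lift : x y / x * y}.
Proof. by move=> x y; rewrite -(clK x) -(clK y) -[cl _ * _]/(fmul (cl _) (cl _)) fmulE !liftE. Qed.
HB.instance Definition _ :=
  monoid.isUMagmaMorphism.Build _ _ freeA_lift (morphM_monoid freeA_liftM).

Lemma freeA_lift_const a : freeA_lift (freeA_const a) = f a.
Proof. exact: liftE. Qed.

Lemma freeA_lift_var i : freeA_lift (freeA_var i) = h i.
Proof. exact: liftE. Qed.

Lemma freeA_lift_uniq (g : {hom freeAGroup -> H}) :
  (forall a, g (freeA_const a) = f a) -> (forall i, g (freeA_var i) = h i) ->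
  g =1 freeA_lift.
Proof.
move=> gf gh x; rewrite -(clK x) liftE.
elim: (repr x) => //= [|s <- t <-|s <-].
- by rewrite -[cl GOne]/(1 : freeAGroup) gmulf1.
- by rewrite -fmulE -[fmul _ _]/(cl _ * cl _) gmulfM.
- by rewrite -finvE -[finv _]/((cl _)^-1) gmulfV.
Qed.

End Lift.

End FreeAGroup.

Notation "A '[X_' m ]" := (freeAGroup A m)
  (at level 2, format "A [X_ m ]") : type_scope.

Definition peval (A : groupType) (m : nat) (a : 'I_m -> A) (s : A[X_m]) : A :=
  freeA_lift idfun a s.

(* An alias of 'I_m -> A, so that the topology below does not compete with the
   product topology. *)
Definition affine (A : groupType) (m : nat) : Type := 'I_m -> A.

Definition zero_locus (A : groupType) (m : nat) (T : set A[X_m]) :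
    set (affine A m) :=
  [set a | forall s, T s -> peval a s = 1].

HB.instance Definition _ (A : groupType) (m : nat) :=
  Choice.copy (affine A m) ('I_m -> A).
HB.instance Definition _ (A : groupType) (m : nat) :=
  @isSubBaseTopological.Build (affine A m) (set A[X_m]) setT
    (fun T => ~` zero_locus T).

Definition algebraic (A : groupType) (m : nat) (Y : set (affine A m)) : Prop :=
  exists T : set A[X_m], Y = zero_locus T.

Definition irreducible (T : topologicalType) (S : set T) : Prop :=
  [/\ S !=set0, closed S &
      forall Z1 Z2, closed Z1 -> closed Z2 -> S = Z1 `|` Z2 ->
        Z1 = S \/ Z2 = S].

Definition irreducible_algebraic (A : groupType) (m : nat)
    (S : set (affine A m)) : Prop :=
  algebraic S /\ irreducible S.

Section CoordinateGroup.
Variables (A : groupType) (m : nat) (Y : set (affine A m)).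

Definition vanishing_set : set A[X_m] :=
  [set s | forall a, Y a -> peval a s = 1].

Lemma vanishing_subgroup : is_subgroup vanishing_set.
Proof.
split=> [a _|s t Is It a Ya]; rewrite /peval; first by rewrite gmulf1.
by rewrite gmulfF [X in X / _]Is // [X in _ / X]It // divg1.
Qed.

Lemma vanishing_conj s g : vanishing_set s -> vanishing_set (s ^ g).
Proof.
move=> Is a Ya; rewrite /peval conjgE !gmulfM gmulfV [X in _ * (X * _)]Is //.
by rewrite mul1g mulVg.
Qed.

Definition vanishing : normalSubgroup A[X_m] :=
  NormalSubgroup vanishing_subgroup vanishing_conj.

Definition coordinateGroup := quotientGroup vanishing.
HB.instance Definition _ := Group.on coordinateGroup.

Definition coord_const (a : A) : coordinateGroup :=
  coset_pi vanishing (freeA_const m a).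

End CoordinateGroup.

(* An A-group is given as a group H with its canonical map j : A -> H. That j is
   injective is not a separate hypothesis: a prime ideal exists only if it is.
   The condition "N (j a) -> a = 1" says that N meets A in 1. *)
Section KrullDimension.
Variables (A : groupType).

Definition discriminated (H : groupType) (j : A -> H) : Prop :=
  forall K : {fset H}, exists f : {hom H -> A},
    (forall a, f (j a) = a) /\ {in K &, injective f}.

Definition prime_ideal (H : groupType) (j : A -> H) (N : normalSubgroup H) :
    Prop :=
  (forall a, N (j a) -> a = 1) /\ discriminated (coset_pi N \o j).

Definition has_prime_chain (H : groupType) (j : A -> H) (k : nat) : Prop :=
  exists p : 'I_k.+1 -> normalSubgroup H,
    (forall i, prime_ideal j (p i)) /\
    (forall i i' : 'I_k.+1, (i < i')%N -> p i `<` p i').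

(* A supremum in the complete chain int U {-oo, +oo}. *)
Definition Kdim (H : groupType) (j : A -> H) : \bar int :=
  supremum -oo%E [set (k%:Z)%:E%E | k in has_prime_chain j].

End KrullDimension.

Section KrullDimensionTheory.
Import Order.TTheory GRing.Theory Num.Theory.

Lemma Kdim_supremums (A H : groupType) (j : A -> H) :
  supremums [set (k%:Z)%:E%E | k in has_prime_chain j] (Kdim j).
Proof.
rewrite /Kdim /supremum; set S := [set _ | _ in _].
case: eqP => [->|/eqP/set0P[_ [k0 Sk0 _]]].
  by split=> [x []|x _]; exact: leNye.
apply: xgetPex.
have [[d dS]|ubS] := pselect (exists d, forall k, has_prime_chain j k -> (k <= d)%N).
  have exS : exists k, `[< has_prime_chain j k >] by exists k0; apply/asboolP.
  have bS k : `[< has_prime_chain j k >] -> (k <= d)%N by move/asboolP/dS.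
  case: (ex_maxnP exS bS) => e /asboolP Se eS; exists (e%:Z%:E)%E; split.
    by move=> _ [k /asboolP Sk <-]; rewrite lee_fin lez_nat eS.
  by move=> y; apply; exists e.
exists +oo%E; split=> [x _|y yS]; first exact: leey.
case: y yS => [r| |] yS //; last by have := yS _ (imageP _ Sk0).
exfalso; apply: ubS; exists `|r|%N => k Sk.
by have := yS _ (imageP _ Sk); rewrite lee_fin => /le_trans/(_ (lez_abs r)).
Qed.

Lemma Kdim_leP (A H : groupType) (j : A -> H) (d : nat) :
  (Kdim j <= (d%:Z)%:E)%E <-> forall k, has_prime_chain j k -> (k <= d)%N.
Proof.
have [ubK leK] := Kdim_supremums j; split=> [Kd k jk|jd].
  by have := le_trans (ubK _ (imageP _ jk)) Kd; rewrite lee_fin.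
by apply: leK => _ [k jk <-]; rewrite lee_fin lez_nat jd.
Qed.

Lemma Kdim_ltyP (A H : groupType) (j : A -> H) :
  (Kdim j < +oo)%E <-> exists d, forall k, has_prime_chain j k -> (k <= d)%N.
Proof.
split=> [|[d /Kdim_leP Kd]]; last exact: le_lt_trans Kd (ltry _).
have [ubK _] := Kdim_supremums j.
case: (Kdim j) ubK => [r| |] // ubK _.
  exists `|r|%N => k jk.
  by have := ubK _ (imageP _ jk); rewrite lee_fin => /le_trans/(_ (lez_abs r)).
by exists 0%N => k jk; have := ubK _ (imageP _ jk).
Qed.

End KrullDimensionTheory.

Definition Kdim_set (A : groupType) (m : nat) (Y : set (affine A m)) : \bar int :=
  Kdim (@coord_const A m Y).

Definition zpower (G : groupType) (x : G) (z : int) : G :=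
  match z with Posz k => x ^+ k | Negz k => x ^- k.+1 end.

(* Z[G], as finitely supported functions G -> Z. *)
Notation groupRing G := {fsfun G -> int with 0%R}.

(* For normal subgroups M <= N of G with N/M abelian: N/M, written
   multiplicatively and as a subset of G/M, is a right Z[G/N]-module, G/N
   acting by conjugation. *)
Section Factor.
Variables (G : groupType) (N M : normalSubgroup G).

Definition factor : set (quotientGroup M) := [set coset_pi M x | x in N].

(* The element x.u of the module. Neither the representative repr c of the
   coset c in G/N nor the order of the product matters, N/M being abelian. *)
Definition factor_act (x : quotientGroup M) (u : groupRing (quotientGroup N)) :
    quotientGroup M :=
  \prod_(c <- finsupp u) zpower (x ^ coset_pi M (repr c)) (u c).

Definition abelian_factor : Prop := {in factor &, forall x y, x * y = y * x}.

Definition torsion_free_factor : Prop :=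
  forall x (u : groupRing (quotientGroup N)), factor x ->
    factor_act x u = 1 -> x = 1 \/ u = [fsfun].

Definition lin_indep (B : set (quotientGroup M)) : Prop :=
  B `<=` factor /\
  forall (s : seq (quotientGroup M))
    (u : quotientGroup M -> groupRing (quotientGroup N)),
    uniq s -> (forall x, x \in s -> B x) ->
    \prod_(x <- s) factor_act x (u x) = 1 ->
    forall x, x \in s -> u x = [fsfun].

Definition is_factor_rank (r : nat) : Prop :=
  exists B, [/\ lin_indep B,
    forall C, lin_indep C -> B `<=` C -> C = B & (B #= `I_r)%card].

End Factor.

(* G = s_0 > s_1 > ... > s_n = 1; s_i is G_(i+1) in the numbering from 1. *)
Definition principal_series (G : groupType) (n : nat)
    (s : 'I_n.+1 -> normalSubgroup G) : Prop :=
  [/\ s ord0 = setT :> set G,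
      s ord_max = [set 1] :> set G &
      forall i : 'I_n,
        let N := s (widen_ord (leqnSn n) i) in
        let M := s (lift ord0 i) in
        [/\ M `<` N, abelian_factor N M & torsion_free_factor N M]].

Definition rigid (n : nat) (G : groupType) : Prop :=
  exists s : 'I_n.+1 -> normalSubgroup G, principal_series s.

Definition is_rigid_rank (n : nat) (G : groupType) (r : n.-tuple nat) : Prop :=
  exists2 s : 'I_n.+1 -> normalSubgroup G, principal_series s &
    forall i : 'I_n, is_factor_rank (s (widen_ord (leqnSn n) i))
                                    (s (lift ord0 i)) (tnth r i).

(* r(G); arbitrarily (0, ..., 0) unless G is n-rigid with finite ranks. *)
Definition rigid_rank (n : nat) (G : groupType) : n.-tuple nat :=
  xget [tuple 0%N | i < n] (@is_rigid_rank n G).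

(* alpha(S) as an element of Z^n with the left lexicographical order. *)
Definition alpha (n : nat) (A : groupType) (m : nat) (S : set (affine A m)) :
    n.-tuplelexi int :=
  [tuple ((tnth (rigid_rank n (coordinateGroup S)) i)%:Z -
          (tnth (rigid_rank n A) i)%:Z)%R | i < n].

(* Main.v *)
Require Import Defs.
From HB Require Import structures.
From mathcomp Require Import all_boot all_order all_algebra finmap.
From mathcomp Require Import all_classical constructive_ereal topology_structure.
From mathcomp Require Import zify.

(** Let H be a group that is A-discriminated by A and generated by A and m
    elements, and let A_i be the principal series of A. The elements of H that
    every retraction H -> A sends into A_i form a principal series of H: the
    condition "h in H_i" is a single equation [a_(n-1), ... [a_i, h]] = 1 with
    constants a_k in A_k outside A_(k+1), so one retraction separates any finite
    set of elements from the terms of the series.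

    The groups H/H_i are iterated extensions of abelian groups, hence amenable.
    A dimension count over Folner sets replaces the Ore localization: it gives
    the Ore condition and the invariance of the rank and, applied to the values
    on the m generators of a cocycle attached to a section H/H_i -> H, the bound
    r_i(A) <= r_i(H) <= r_i(A) + m.

    A proper A-epimorphism H -> H' between such groups induces isomorphisms on
    the first factors of the series. On the first factor with a nonzero kernel
    a basis of the image, lifted, stays independent after a kernel element is
    added, so r(H') < r(H) lexicographically. Hence the ranks along a chain of
    prime ideals are distinct points of a box with (m + 1)^n elements. *)

Set Implicit Arguments.
Unset Strict Implicit.
Unset Printing Implicit Defensive.

Import Order.TTheory GRing.Theory Num.Theory.

(** * Integer linear systems with more unknowns than equations *)

Section IntegerRelations.
Local Open Scope ring_scope.

(** In the Smith form $M = L D R$ the row of index [b] of the diagonal matrix $D$ is zero, so the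
    row of index [b] of $L^{-1}$ annihilates [M]; it is nonzero because $L$ is invertible. *)
Lemma int_mx_kernel (a b : nat) (M : 'M[int]_(a, b)) : (b < a)%N ->
  exists2 z : 'rV[int]_a, z != 0 & z *m M = 0.
Proof.
move=> ltba; have [L Lu [R Ru [d _ ->]]] := int_Smith_normal_form M.
pose i := Ordinal ltba; exists (row i (invmx L)).
  apply/eqP => z0; have := mulVmx Lu => /(congr1 (row i)).
  rewrite row_mul z0 mul0mx => /rowP/(_ i); rewrite !mxE eqxx => /eqP.
  by rewrite eq_sym oner_eq0.
rewrite -row_mul mulmxA mulKmx // row_mul [row i _](_ : _ = 0) ?mul0mx //.
by apply/rowP => j; rewrite !mxE /= (gtn_eqF (ltn_ord j)).
Qed.

Lemma int_relation (R C : eqType) (r : seq R) (c : seq C) (M : R -> C -> int) :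
  uniq r -> (size c < size r)%N ->
  exists2 z : R -> int, exists2 x, x \in r & z x != 0 &
    forall y, y \in c -> \sum_(x <- r) z x * M x y = 0.
Proof.
case: r => [|x0 r] // ur ltcr; set r0 := x0 :: r.
case: c ltcr => [|y0 c] ltcr; first by exists (fun=> 1) => //; exists x0; rewrite ?mem_head.
set c0 := y0 :: c.
have [z /rV0Pn[i zi] zM] := @int_mx_kernel _ _
  (\matrix_(i < size r0, j < size c0) M (nth x0 r0 i) (nth y0 c0 j)) ltcr.
pose zz x := if insub (index x r0) is Some k then z 0 k else 0.
have zzE (k : 'I_(size r0)) : zz (nth x0 r0 k) = z 0 k.
  by rewrite /zz index_uniq // valK.
exists zz => [|y yc]; first by exists (nth x0 r0 i); rewrite ?mem_nth // zzE.
move: zM => /rowP/(_ (Ordinal (etrans (index_mem y c0) yc))).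
rewrite !mxE (big_nth x0) big_mkord; apply: etrans; apply: eq_bigr => k _.
by rewrite zzE mxE /= nth_index.
Qed.

End IntegerRelations.

(** Bernoulli's inequality gives $(1 + 1/k)^k \ge 2$ for $k \ge 1$. Hence for $L = kt$ the ratio
    $((k+1)/k)^L$ is at least $2^t$, which outgrows $(L+1)^l$. *)
Lemma exp_beats_poly (k l : nat) :
  exists L, (k ^ L * L.+1 ^ l < k.+1 ^ L)%N.
Proof.
have bern t : (k ^ t * t <= k * ((k.+1) ^ t - k ^ t))%N.
  elim: t => [|t IH]; first by rewrite muln0.
  have le : (k ^ t <= k.+1 ^ t)%N by case: (t) => // t'; rewrite leq_exp2r.
  rewrite !expnS; move: IH le; set a := (k ^ t)%N; set b := (k.+1 ^ t)%N; nia.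
case: k bern => [|k] bern; first by exists 1; rewrite exp1n expn1 mul0n.
have double : (2 * k.+1 ^ k.+1 <= k.+2 ^ k.+1)%N.
  by have := bern k.+1; set a := (k.+1 ^ _)%N; set b := (k.+2 ^ _)%N; nia.
(* From here on [k.+1] stands for the original [k]. The factor 8 makes $v$ so large that $v^2 < 4
   \cdot 2^v$ implies $l(k+1+v) < 2^v = t$, which compares the exponents of $(L+1)^l \le
   2^{l(k+1+v)}$ and $2^t$. *)
pose v := (8 * l.+1 * k.+2)%N.
pose t := (2 ^ v)%N.
exists (k.+1 * t)%N; rewrite (expnM k.+1) (expnM k.+2).
have pos : (0 < k.+1 ^ k.+1)%N by rewrite expn_gt0.
apply: (@leq_trans ((2 * k.+1 ^ k.+1) ^ t)%N); last by rewrite leq_exp2r // expn_gt0.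
rewrite expnMn mulnC ltn_pmul2r ?expn_gt0 ?pos //.
have -> : ((k.+1 * t).+1 ^ l < 2 ^ t)%N; last by [].
have h1 : ((k.+1 * t).+1 <= 2 ^ (k.+1 + v))%N.
  have t_gt0 : (0 < t)%N by rewrite expn_gt0.
  have := ltn_expl k.+1 (ltnSn 1); rewrite expnD -/t.
  by move: (2 ^ k.+1)%N => a; move: (t) t_gt0 => b; nia.
apply: (@leq_ltn_trans ((2 ^ (k.+1 + v)) ^ l)%N).
  by case: (l) => // l'; rewrite leq_exp2r.
rewrite -expnM ltn_exp2l // /t.
have h2 : (v * v < 2 ^ v * 4)%N.
  pose w := (v./2)%N; have h3 := ltn_expl w (ltnSn 1).
  have h4 : (2 ^ w * 2 ^ w <= 2 ^ v)%N by rewrite -expnD leq_exp2l // /w addnn; have := odd_double_half v; lia.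
  have h5 : (v <= w + w + 1)%N by have := odd_double_half v; rewrite -/w -addnn; case: odd => /=; lia.
  by move: (2 ^ w)%N (2 ^ v)%N h3 h4 => a b; nia.
move: (2 ^ v)%N h2 => a; rewrite /v; nia.
Qed.

(** * Folner sets and products of finite sets *)

Section Folner.
Local Open Scope group_scope.

Definition set_mul (G : groupType) (S F : seq G) : seq G :=
  undup [seq x * y | x <- S, y <- F].

(* Left Folner sets, in the form "|S F| / |F| < (k + 1) / k". *)
Definition folner (G : groupType) : Prop :=
  forall (S : seq G) (k : nat), exists2 F : seq G, uniq F &
    (k * size (set_mul S F) < k.+1 * size F)%N.

Lemma set_mulP (G : groupType) (S F : seq G) z :
  reflect (exists x y, [/\ x \in S, y \in F & z = x * y]) (z \in set_mul S F).
Proof.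
rewrite mem_undup; apply: (iffP allpairsP) => [[[x y] /= [? ? ->]]|[x [y [? ? ->]]]].
  by exists x, y.
by exists (x, y).
Qed.

Lemma folner_trivial (G : groupType) : (forall x : G, x = 1) -> folner G.
Proof.
move=> G1 S k; exists [:: 1] => //=; rewrite muln1 ltnS -[leqRHS]muln1 leq_mul2l.
apply/orP; right; apply: (@uniq_leq_size _ _ [:: 1]); first exact: undup_uniq.
by move=> x _; rewrite (G1 x) mem_head.
Qed.

End Folner.

(** * Folner sets from commuting elements and in extensions with abelian kernel *)

Section FolnerExtension.
Local Open Scope group_scope.

Section Commuting.
Variable G : groupType.

(** The products $c_1^{i_1} \cdots c_r^{i_r}$ with exponents at most [L], listed with repetitions.
    When the $c_i$ commute they cover the ball of radius [L], which gives polynomial growth. *)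
Fixpoint box (C : seq G) (L : nat) : seq G :=
  if C is c :: C' then [seq c ^+ i * x | i <- iota 0 L.+1, x <- box C' L]
  else [:: 1].

Lemma size_box C L : size (box C L) = (L.+1 ^ size C)%N.
Proof.
elim: C => [|c C IH] //.
by rewrite (size_allpairs (fun i x => c ^+ i * x)) size_iota IH -expnS.
Qed.

Lemma box_consP c C L x :
  reflect (exists i y, [/\ (i <= L)%N, y \in box C L & x = c ^+ i * y])
          (x \in box (c :: C) L).
Proof.
apply: (iffP allpairsP) => [[[i y] /= [iL yC ->]]|[i [y [iL yC ->]]]].
  by exists i, y; split=> //; move: iL; rewrite -[0%N :: _]/(iota 0 L.+1) mem_iota.
by exists (i, y); split=> //=; rewrite -[0%N :: _]/(iota 0 L.+1) mem_iota.
Qed.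

Lemma box1 C L : 1 \in box C L.
Proof.
elim: C => [|c C IH]; first exact: mem_head.
by apply/box_consP; exists 0%N, 1; rewrite mulg1.
Qed.

Lemma box_widen C L x : x \in box C L -> x \in box C L.+1.
Proof.
elim: C x => [|c C IH] x //= /box_consP[i [y [iL yC ->]]].
by apply/box_consP; exists i, y; split; [exact: leqW | exact: IH |].
Qed.

Lemma box_mul (C : seq G) L c x :
  {in C &, forall a b : G, a * b = b * a} ->
  c \in C -> x \in box C L -> c * x \in box C L.+1.
Proof.
elim: C x => [|c0 C IH] x // comm; rewrite inE => cC /box_consP[i [y [iL yC ->]]].
have commC : {in C &, forall a b, a * b = b * a}.
  by move=> a b aC bC; apply: comm; rewrite inE ?aC ?bC orbT.
apply/box_consP; case: (eqVneq c c0) cC => [-> _|_ /= cC].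
  by exists i.+1, y; split=> //; [exact: box_widen | rewrite mulgA expgS].
exists i, (c * y); split; [exact: leqW | exact: IH |].
have cc0 : commute c (c0 ^+ i).
  by apply: commuteX; apply: comm; rewrite inE ?cC ?orbT ?eqxx.
by rewrite !mulgA cc0.
Qed.

(** If no ball were a Folner set, the balls would grow by a factor of at least $(k+1)/k$ at each
    step, whereas commutativity bounds their size by a polynomial in the radius. The predicate [P]
    serves to keep the set inside the kernel of an extension. *)
Lemma folner_commuting (P : G -> Prop) (C : seq G) (k : nat) :
  P 1 -> (forall x y, P x -> P y -> P (x * y)) -> (forall x, x \in C -> P x) ->
  {in C &, forall a b, a * b = b * a} ->
  exists F, [/\ uniq F, forall x, x \in F -> P x &
    (k * size (set_mul C F) < k.+1 * size F)%N].
Proof.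
move=> P1 PM PC comm.
pose ball L := iter L (set_mul (1 :: C)) [:: 1].
have ballS L : ball L.+1 = set_mul (1 :: C) (ball L) by [].
have ballP L x : x \in ball L -> P x.
  elim: L x => [|L IH] x; first by rewrite inE => /eqP ->.
  rewrite ballS => /set_mulP[a [b [aC /IH Pb ->]]]; apply: PM => //.
  by move: aC; rewrite inE => /predU1P[->|/PC].
have ball_box L : {subset ball L <= box C L}.
  elim: L => [|L IH] x; first by rewrite inE => /eqP ->; exact: box1.
  rewrite ballS => /set_mulP[a [b [aC /IH bb ->]]].
  move: aC; rewrite inE => /predU1P[->|aC]; last exact: box_mul.
  by rewrite mul1g; exact: box_widen.
have uball L : uniq (ball L) by case: L => [|L] //; exact: undup_uniq.
have [[L HL]|H] := pselect (exists L, (k * size (ball L.+1) < k.+1 * size (ball L))%N).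
  exists (ball L); split=> //; first exact: ballP.
  apply: leq_ltn_trans HL; rewrite leq_mul2l; apply/orP; right.
  apply: uniq_leq_size; first exact: undup_uniq.
  move=> x /set_mulP[a [b [aC bb ->]]]; rewrite ballS; apply/set_mulP.
  by exists a, b; rewrite inE aC orbT.
have grow L : (k.+1 ^ L <= k ^ L * size (ball L))%N.
  elim: L => [|L IH] //; rewrite !expnS.
  have HL : (k.+1 * size (ball L) <= k * size (ball L.+1))%N.
    by rewrite leqNgt; apply/negP => HL; apply: H; exists L.
  move: (k.+1 ^ L)%N (k ^ L)%N (size (ball L)) (size (ball L.+1)) IH HL => a b r r' IH HL.
  apply: (@leq_trans (k.+1 * (b * r))%N); first by rewrite leq_mul2l IH.
  by rewrite mulnCA [leqRHS]mulnAC mulnC leq_mul2r HL orbT.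
have [L HL] := exp_beats_poly k (size C).
suff : (k ^ L * size (ball L) <= k ^ L * L.+1 ^ size C)%N.
  by have := grow L; lia.
rewrite leq_mul2l -size_box; apply/orP; right.
exact: uniq_leq_size.
Qed.

End Commuting.

(** The section [t] is only set-theoretic: $s\,t(q) = t(p(s)q)\,c(s,q)$ with $c(s,q)$ in the kernel.
    The Folner set consists of the products $t(q)f$, with $q$ in a Folner set of [Q] and $f$ in a
    Folner set of the kernel for the finitely many $c(s,q)$. *)
Lemma folner_extension (E Q : groupType) (p : E -> Q) (t : Q -> E) :
  {morph p : x y / x * y} -> cancel t p ->
  (forall x y, p x = 1 -> p y = 1 -> x * y = y * x) ->
  folner Q -> folner E.
Proof.
move=> pM tK comm folQ S k.
have p1 : p 1 = 1 by apply: (mulgI (p 1)); rewrite -pM !mulg1.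
have pV x : p x^-1 = (p x)^-1 by apply: (mulgI (p x)); rewrite -pM !mulgV.
(* The constant $2k+1$ serves for both sets because $k(2k+2)^2 < (k+1)(2k+1)^2$. *)
have [FQ uFQ ltQ] := folQ [seq p s | s <- S] (2 * k + 1)%N.
pose c s q := (t (p s * q))^-1 * (s * t q).
have [] := @folner_commuting E (fun x => p x = 1) [seq c s q | s <- S, q <- FQ]
  (2 * k + 1)%N p1.
- by move=> x y px py; rewrite pM px py mulg1.
- by move=> _ /allpairsP[[s q] /= [_ _ ->]]; rewrite !pM pV !tK mulVg.
- by move=> _ _ /allpairsP[[s q] /= [_ _ ->]] /allpairsP[[s' q'] /= [_ _ ->]];
    apply: comm; rewrite !pM pV !tK mulVg.
move=> FK [uFK pFK ltK]; pose F := [seq t q * f | q <- FQ, f <- FK]; exists F.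
  apply: allpairs_uniq => // -[q f] [q' f'] /allpairsP[[a b] /= [aQ bK [-> ->]]].
  move=> /allpairsP[[a' b'] /= [aQ' bK' [-> ->]]] /= eqt.
  have := congr1 p eqt; rewrite !pM !tK !pFK // !mulg1 => eqa.
  by move: eqt; rewrite eqa => /mulgI ->.
have le : (size (set_mul S F) <=
    size (set_mul [seq p s | s <- S] FQ) *
    size (set_mul [seq c s q | s <- S, q <- FQ] FK))%N.
  rewrite -(size_allpairs (fun (q : Q) (f : E) => t q * f)%g).
  apply: uniq_leq_size; first exact: undup_uniq.
  move=> _ /set_mulP[s [_ [sS /allpairsP[[q f] /= [qQ fK ->]] ->]]].
  apply/allpairsP; exists (p s * q, c s q * f); split=> /=.
  - by apply/set_mulP; exists (p s), q; rewrite map_f.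
  - apply/set_mulP; exists (c s q), f; split=> //.
    by apply/allpairsP; exists (s, q).
  - by rewrite /c -!mulgA mulVKg !mulgA.
move: ltQ ltK le; rewrite size_allpairs.
move: (size _) (size _) (size _) (size _) (size _) => a b x y z.
nia.
Qed.

End FolnerExtension.

(** * Modules over an integral group ring and the dimension count *)

Section GroupRingModules.
Local Open Scope ring_scope.

Definition zclosed (V : zmodType) (W : V -> Prop) : Prop :=
  W 0 /\ forall x y, W x -> W y -> W (x - y).

Section ZClosed.
Variables (V : zmodType) (W : V -> Prop).
Hypothesis HW : zclosed W.

Lemma zclosedN x : W x -> W (- x).
Proof. by rewrite -sub0r; apply: HW.2; exact: HW.1. Qed.

Lemma zclosedD x y : W x -> W y -> W (x + y).
Proof. by move=> Wx Wy; rewrite -[y]opprK; apply: HW.2 => //; exact: zclosedN. Qed.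

Lemma zclosedMz x (z : int) : W x -> W (x *~ z).
Proof.
move=> Wx; have WMn n : W (x *+ n).
  by elim: n => [|n IH]; [exact: HW.1 | rewrite mulrS; exact: zclosedD].
by case: z => n; [exact: WMn | rewrite NegzE mulrNz; apply: zclosedN; exact: WMn].
Qed.

Lemma zclosed_sum (I : eqType) (r : seq I) (F : I -> V) :
  (forall i, i \in r -> W (F i)) -> W (\sum_(i <- r) F i).
Proof.
move=> WF; rewrite big_seq; elim/big_ind: _ => //; first exact: HW.1.
exact: zclosedD.
Qed.

End ZClosed.

(* Elements of Z[Q] are represented by lists of terms, with repetitions. *)
Definition scalar (Q : groupType) := seq (Q * int).

Section Scalars.
Variable Q : groupType.
Implicit Types (u w : scalar Q) (q : Q).

Definition coef u q : int := \sum_(p <- u | p.1 == q) p.2.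

Definition null_scalar u : Prop := forall q, coef u q = 0.

Definition mulsc u w : scalar Q :=
  [seq ((p.1 * r.1)%g, p.2 * r.2) | p <- u, r <- w].

Definition oppsc u : scalar Q := [seq (p.1, - p.2) | p <- u].

Lemma coef_cat u w q : coef (u ++ w) q = coef u q + coef w q.
Proof. by rewrite /coef big_cat. Qed.

Lemma coef_opp u q : coef (oppsc u) q = - coef u q.
Proof. by rewrite /coef big_map sumrN. Qed.

Lemma coef_map (F : seq Q) (z : Q -> int) q : uniq F ->
  coef [seq (t, z t) | t <- F] q = if q \in F then z q else 0.
Proof.
move=> uF; rewrite /coef big_map /=; case: ifPn => qF.
  by rewrite (big_rem q) //= eqxx big1_seq ?addr0 // => t /andP[/eqP->];
     rewrite mem_rem_uniq // inE eqxx.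
by rewrite big1_seq // => t /andP[/eqP -> /negPn]; rewrite qF.
Qed.

Lemma one_nonnull : ~ null_scalar [:: (1%g, 1)].
Proof. by move/(_ 1%g); rewrite /coef big_cons big_nil /= eqxx addr0. Qed.

End Scalars.

Record module_action (Q : groupType) (V : zmodType) (act : Q -> V -> V) : Prop :=
  ModuleAction {
    actB : forall q x y, act q (x - y) = act q x - act q y;
    act1 : forall x, act 1%g x = x;
    actM : forall q r x, act (q * r)%g x = act r (act q x)
  }.

Section Modules.
Variables (Q : groupType) (V : zmodType) (act : Q -> V -> V).
Hypothesis actP : module_action act.
Implicit Types (u w : scalar Q) (q : Q) (x y v : V) (W : V -> Prop) (b d s : seq V).

Lemma act0 q : act q 0 = 0.
Proof. by rewrite -[X in act q X](subrr 0) (actB actP) subrr. Qed.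
Lemma actN q x : act q (- x) = - act q x.
Proof. by rewrite -sub0r (actB actP) act0 sub0r. Qed.
Lemma actD q x y : act q (x + y) = act q x + act q y.
Proof. by rewrite -[y]opprK (actB actP) -actN. Qed.
Lemma actMz q x z : act q (x *~ z) = act q x *~ z.
Proof.
have H n : act q (x *+ n) = act q x *+ n.
  by elim: n => [|n IH]; rewrite ?act0 // !mulrS actD IH.
by case: z => n; [exact: H | rewrite NegzE !mulrNz actN -!pmulrn H].
Qed.
Lemma act_sum (I : Type) (r : seq I) (F : I -> V) q :
  act q (\sum_(i <- r) F i) = \sum_(i <- r) act q (F i).
Proof. by elim/big_rec2: _ => [|i x y _ <-]; rewrite ?act0 ?actD. Qed.

Definition scal x u : V := \sum_(p <- u) act p.1 x *~ p.2.

Lemma scal0 u : scal 0 u = 0.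
Proof. by rewrite /scal big1 // => p _; rewrite act0 mul0rz. Qed.

Lemma scalB x y u : scal (x - y) u = scal x u - scal y u.
Proof. by rewrite /scal -sumrB; apply: eq_bigr => p _; rewrite (actB actP) mulrzBl. Qed.

Lemma scal_cat x u w : scal x (u ++ w) = scal x u + scal x w.
Proof. by rewrite /scal big_cat. Qed.

Lemma scal_opp x u : scal x (oppsc u) = - scal x u.
Proof. by rewrite /scal big_map -sumrN; apply: eq_bigr => p _; rewrite mulrNz. Qed.

Lemma scal_nil x : scal x [::] = 0.
Proof. by rewrite /scal big_nil. Qed.

Lemma scal_one x : scal x [:: (1%g, 1)] = x.
Proof. by rewrite /scal big_seq1 /= (act1 actP) mulr1z. Qed.

Lemma scalM x u w : scal x (mulsc u w) = scal (scal x u) w.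
Proof.
rewrite /scal /mulsc big_allpairs_dep exchange_big /=; apply: eq_bigr => r _.
rewrite act_sum mulrz_suml; apply: eq_bigr => p _.
by rewrite (actM actP) actMz mulrzA.
Qed.

(** Collecting terms by group element shows that the product depends on [u] only through its
    coefficients, so repetitions in the list are harmless. *)
Lemma scal_coef x u (T : seq Q) : uniq T -> {subset map fst u <= T} ->
  scal x u = \sum_(q <- T) act q x *~ coef u q.
Proof.
move=> uT uT'; rewrite /scal big_seq.
rewrite (eq_bigr (fun p => \sum_(q <- T | q == p.1) act q x *~ p.2)).
  rewrite -big_seq (exchange_big_dep xpredT) //=; apply: eq_bigr => q _.
  rewrite /coef mulrz_sumr; apply: eq_bigl => p; exact: eq_sym.
move=> p pu; rewrite -big_filter.
have -> : [seq q <- T | q == p.1] = [:: p.1]; last by rewrite big_seq1.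
by apply/perm_small_eq => //; apply: uniq_perm; rewrite ?filter_uniq // => q;
   rewrite mem_filter inE andb_idr // => /eqP ->; apply: uT'; exact: map_f.
Qed.

Lemma scal_null x u : null_scalar u -> scal x u = 0.
Proof.
move=> u0; rewrite (scal_coef x (undup_uniq (map fst u))).
  by rewrite big1 // => q _; rewrite u0 mulr0z.
by move=> q; rewrite mem_undup.
Qed.

Definition free_seq s : Prop :=
  uniq s /\ forall u : V -> scalar Q, \sum_(x <- s) scal x (u x) = 0 ->
    forall x, x \in s -> null_scalar (u x).

Section Counting.
Variables (W : V -> Prop) (m : nat) (y : 'I_m -> Q -> V).
Hypothesis HW : zclosed W.

(** The subgroup generated by [W] and the [y i t] with [t] in [T]. The family [y] is an arbitrary
    function so as to cover both translates of a basis and values of a cocycle. *)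
Definition zspan (T : seq Q) (v : V) : Prop :=
  exists z : 'I_m -> Q -> int,
    W (v - \sum_i \sum_(t <- T) y i t *~ z i t).

Lemma zspan_closed T : zclosed (zspan T).
Proof.
split=> [|v v' [z Wz] [z' Wz']].
  exists (fun _ _ => 0); rewrite big1 ?subr0; first exact: HW.1.
  by move=> i _; rewrite big1 // => t _; rewrite mulr0z.
exists (fun i t => z i t - z' i t).
have := HW.2 _ _ Wz Wz'; congr W.
have -> : \sum_i \sum_(t <- T) y i t *~ (z i t - z' i t) =
    \sum_i \sum_(t <- T) y i t *~ z i t - \sum_i \sum_(t <- T) y i t *~ z' i t.
  rewrite -sumrB; apply: eq_bigr => i _; rewrite -sumrB.
  by apply: eq_bigr => t _; rewrite mulrzBr.
by rewrite !opprB [_ - v']addrC addrACA [- _ + _]addrC.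
Qed.

Lemma zspan_sub T v : W v -> zspan T v.
Proof.
move=> Wv; exists (fun _ _ => 0); rewrite big1 ?subr0 //.
by move=> i _; rewrite big1 // => t _; rewrite mulr0z.
Qed.

Lemma zspan_gen T i t : uniq T -> t \in T -> zspan T (y i t).
Proof.
move=> uT tT; exists (fun i' t' => ((i' == i) && (t' == t))%:Z).
rewrite (bigD1 i) //= (bigD1_seq t) //= !eqxx !big1 ?addr0 ?subrr ?mulr1z //.
- exact: HW.1.
- by move=> i' /negPf ->; rewrite big1.
- by move=> t' /negPf ->; rewrite mulr0z.
Qed.

End Counting.

Hypothesis folQ : folner Q.

(* The translates of size d many elements by a large Folner set F lie in
   the sum of W and a group with at most m * |K F| < size d * |F|
   generators. *)
Lemma counting W m (y : 'I_m -> Q -> V) d (e : V -> V) :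
  zclosed W -> uniq d -> (m < size d)%N ->
  (forall x, x \in d -> exists kappa : seq Q, forall q T, uniq T ->
     (forall k, k \in kappa -> (k * q)%g \in T) -> zspan W y T (act q (e x))) ->
  exists u : V -> scalar Q, W (\sum_(x <- d) scal (e x) (u x)) /\
    exists2 x, x \in d & ~ null_scalar (u x).
Proof.
move=> HW ud ltmd genx.
have : forall x, exists kappa : seq Q, x \in d -> forall q T, uniq T ->
     (forall k, k \in kappa -> (k * q)%g \in T) -> zspan W y T (act q (e x)).
  by move=> x; have [/genx[K HK]|_] := boolP (x \in d); [exists K | exists [::]].
move=> /choice[K HK]; pose kappa := flatten [seq K x | x <- d].
have gen x q T : x \in d -> uniq T -> (forall k, k \in kappa -> (k * q)%g \in T) ->
    zspan W y T (act q (e x)).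
  move=> xd uT kT; apply: HK => // k kK; apply: kT.
  by apply/flatten_mapP; exists x.
(* With constant [m], $m\,|\kappa F| < (m+1)|F| \le |d|\,|F|$: the translates outnumber the
   generators. *)
have [F uF ltF] := folQ kappa m.
set T := set_mul kappa F in ltF.
pose r := [seq (x, q) | x <- d, q <- F].
have : forall p : V * Q, exists z : 'I_m -> Q -> int, p \in r ->
    W (act p.2 (e p.1) - \sum_i \sum_(t <- T) y i t *~ z i t).
  move=> p; have [pr|//] := boolP (p \in r); last by exists (fun _ _ => 0).
  have /allpairsP[[x q] /= [xd qF ->]] := pr.
  have [|z Wz] := gen x q T xd (undup_uniq _); last by exists z.
  by move=> k kk; apply/set_mulP; exists k, q.
move=> /choice[Z WZ].
have [||z [p0 p0r zp0] zZ] :=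
  @int_relation _ _ r [seq (i, t) | i <- enum 'I_m, t <- T] (fun p it => Z p it.1 it.2).
- by apply: allpairs_uniq => // -[? ?] [? ?].
- rewrite !size_allpairs -cardE card_ord; apply: leq_trans ltF _.
  by rewrite leq_mul2r ltmd orbT.
(* The integer relation is read as group ring coefficients $u_x = \sum_{q \in F} z(x,q)\,q$. *)
exists (fun x => [seq (q, z (x, q)) | q <- F]); split; last first.
  move: p0r zp0 => /allpairsP[[x q] /= [xd qF ->]] zp0; exists x => // /(_ q).
  by rewrite coef_map // qF; exact/eqP.
(* Subtracting from each translate its combination of generators leaves the sum unchanged, since the
   relation kills every column; the remaining summands lie in [W]. *)
have -> : \sum_(x <- d) scal (e x) [seq (q, z (x, q)) | q <- F] =
    \sum_(p <- r) (act p.2 (e p.1) - \sum_i \sum_(t <- T) y i t *~ Z p i t) *~ z p.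
  apply/eqP; rewrite -subr_eq0; apply/eqP.
  under [X in _ - X]eq_bigr do rewrite mulrzBl.
  rewrite sumrB big_allpairs /= opprB addrCA.
  under [X in X - _]eq_bigr do rewrite /scal big_map.
  rewrite subrr addr0 (eq_bigr (fun p => \sum_i \sum_(t <- T) y i t *~ (z p * Z p i t))).
    rewrite exchange_big big1 // => i _; rewrite exchange_big big1_seq // => t /= tT; rewrite -mulrz_sumr.
    have -> /= := zZ (i, t); last by apply/allpairsP; exists (i, t); rewrite mem_enum.
    by rewrite mulr0z.
  move=> p _; rewrite mulrz_suml; apply: eq_bigr => i _.
  by rewrite mulrz_suml; apply: eq_bigr => t _; rewrite mulrC mulrzA.
by apply: zclosed_sum => // p pr; apply: zclosedMz => //; exact: WZ.
Qed.

End Modules.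

End GroupRingModules.

(** * Rank of a torsion free module over the group ring *)

Section Rank.
Local Open Scope ring_scope.
Variables (Q : groupType) (V : zmodType) (act : Q -> V -> V).
Hypothesis actP : module_action act.
Hypothesis folQ : folner Q.
Local Notation scal := (scal act).
Hypothesis tf : forall (x : V) (u : scalar Q), scal x u = 0 -> x = 0 \/ null_scalar u.
Implicit Types (u w : scalar Q) (q : Q) (x y v : V) (b d s : seq V).

Definition submod (P : V -> Prop) : Prop :=
  zclosed P /\ forall q x, P x -> P (act q x).

Definition span b v : Prop :=
  forall P, submod P -> (forall x, x \in b -> P x) -> P v.

(** The trace on [V] of the subspace spanned by [b] once the nonzero scalars are inverted. *)
Definition cl b v : Prop := exists2 w, ~ null_scalar w & span b (scal v w).

(** Linear independence in the quotient of the localized space by the span of [b]. *)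
Definition indep b d : Prop :=
  uniq d /\ forall u : V -> scalar Q, cl b (\sum_(x <- d) scal x (u x)) ->
    forall x, x \in d -> null_scalar (u x).

Lemma submod_scal P x u : submod P -> P x -> P (scal x u).
Proof.
move=> [Pz Pact] Px; apply: zclosed_sum => // p _.
by apply: zclosedMz => //; exact: Pact.
Qed.

Lemma submod_span b : submod (span b).
Proof.
split; first split=> [P [Pz _] _|x y sx sy P PP Pb].
- exact: Pz.1.
- by apply: PP.1.2; [exact: sx | exact: sy].
- by move=> q x sx P PP Pb; apply: PP.2; exact: sx.
Qed.

Lemma mem_span b x : x \in b -> span b x.
Proof. by move=> xb P _; exact. Qed.

Lemma span_scal b x u : span b x -> span b (scal x u).
Proof. exact: (@submod_scal (span b) x u (submod_span b)). Qed.

Lemma spanB b x y : span b x -> span b y -> span b (x - y).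
Proof. exact: (submod_span b).1.2. Qed.

Lemma submod0 : submod (fun v => v = 0).
Proof.
split; first by split=> // x y -> ->; rewrite subr0.
by move=> q x ->; exact: (act0 actP).
Qed.

(** The dimension count with [W] zero and the translates of [b] as generators. It comes before the
    Ore condition, which is deduced from it. *)
Lemma span_dependent b d (e : V -> V) :
  uniq d -> (size b < size d)%N -> (forall x, x \in d -> span b (e x)) ->
  exists2 u : V -> scalar Q, \sum_(x <- d) scal (e x) (u x) = 0 &
    exists2 x, x \in d & ~ null_scalar (u x).
Proof.
move=> ud lt sp; pose y (i : 'I_(size b)) q := act q b`_i.
have [|u [u0 un]] := @counting _ _ act folQ (fun v => v = 0) _ y d e submod0.1 ud lt; last by exists u.
(* The elements whose translates are controlled by some finite [kappa] form a submodule containing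
   [b], hence containing its span. *)
move=> x xd; pose P v := exists kappa : seq Q, forall q T, uniq T ->
  (forall k, k \in kappa -> (k * q)%g \in T) -> zspan (fun v => v = 0) y T (act q v).
apply: (sp x xd P); last first.
  move=> z zb; exists [:: 1%g] => q T uT kT.
  have lt' : (index z b < size b)%N by rewrite index_mem.
  have -> : act q z = y (Ordinal lt') q by rewrite /y /= nth_index.
  apply: zspan_gen => //; first exact: submod0.1.
  by rewrite -[q]mul1g kT ?mem_head.
split; first split.
- exists [::] => q T uT _; rewrite (act0 actP).
  by apply: zspan_sub.
- move=> v v' [K HK] [K' HK']; exists (K ++ K') => q T uT kT; rewrite (actB actP).
  apply: (zspan_closed y submod0.1 T).2.
    by apply: HK => // k kK; apply: kT; rewrite mem_cat kK.
  by apply: HK' => // k kK; apply: kT; rewrite mem_cat kK orbT.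
- move=> g v [K HK]; exists [seq (k * g)%g | k <- K] => q T uT kT.
  rewrite -(actM actP); apply: HK => // k kK; rewrite mulgA; apply: kT.
  exact: map_f.
Qed.

Section NonZero.
Variable x0 : V.
Hypothesis x0n : x0 <> 0.

(** Since $x_0(uw) = (x_0u)w$, torsion freeness applied twice at one nonzero element shows that the
    group ring has no zero divisors. *)
Lemma mulsc_nonnull u w : ~ null_scalar u -> ~ null_scalar w ->
  ~ null_scalar (mulsc u w).
Proof.
move=> un wn n; have : scal x0 (mulsc u w) = 0 by exact: scal_null.
by rewrite (scalM actP) => /tf[/tf[|]|].
Qed.

(** Both $x_0u$ and $x_0w$ lie in the span of the single element $x_0$, hence are dependent. Torsion
    freeness turns the dependence into an identity of scalars, valid on all of [V]. *)
Lemma ore u w : ~ null_scalar u -> ~ null_scalar w ->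
  exists a a', [/\ ~ null_scalar a, ~ null_scalar a' &
    forall x, scal (scal x u) a = scal (scal x w) a'].
Proof.
move=> un wn.
have sp z : span [:: x0] (scal x0 z).
  by apply: span_scal; apply: mem_span; exact: mem_head.
(* Here [0] and [x0] are only two distinct labels, for [w] and [u] respectively. *)
have u0 : uniq [:: 0; x0] by rewrite /= inE andbT; apply/eqP => /esym.
have [//|x _|a] := @span_dependent [:: x0] [:: 0; x0]
  (fun x => if x == 0 then scal x0 w else scal x0 u) u0; first by case: ifP.
have /negPf x00 : x0 != 0 by exact/eqP.
rewrite !big_cons big_nil eqxx x00 addr0 -!(scalM actP) -scal_cat => /tf[//|cat0].
have E x : scal (scal x u) (a x0) = scal (scal x w) (oppsc (a 0)).
  apply/eqP; rewrite scal_opp -subr_eq0 opprK addrC -!(scalM actP) -scal_cat.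
  by apply/eqP; exact: scal_null.
move=> an; exists (a x0), (oppsc (a 0)).
have oppn : null_scalar (oppsc (a 0)) -> null_scalar (a 0).
  by move=> + q => /(_ q); rewrite coef_opp => /eqP; rewrite oppr_eq0 => /eqP.
have key : ~ (null_scalar (a x0) /\ null_scalar (a 0)).
  by case: an => x; rewrite !inE => /orP[] /eqP -> + [].
split=> // n; apply: key; split=> //.
- have := E x0; rewrite (scal_null _ _ n) => /esym/tf[/tf[//|//]|/oppn //].
- have := E x0; rewrite (scal_null _ _ n) => /tf[/tf[//|//]|//].
- exact: oppn.
Qed.

End NonZero.

Lemma span_cl b v : span b v -> cl b v.
Proof.
by exists [:: (1%g, 1)]; [exact: one_nonnull | rewrite (scal_one actP)].
Qed.

Lemma cl0 b : cl b 0.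
Proof. by apply: span_cl; exact: (submod_span b).1.1. Qed.

(** Differences need a common denominator, supplied by the Ore condition; for the translate of an
    element by $q$ the denominator $w$ becomes $q^{-1}w$. *)
Lemma submod_cl b : submod (cl b).
Proof.
split; first split=> [|x x' [w wn sw] [w' wn' sw']]; first exact: cl0.
  (* The Ore condition was obtained from a nonzero element of [V], so the zero module is treated
     apart. *)
  have [x0n|xx] := pselect (exists x0 : V, x0 <> 0); last first.
    have V0 v : v = 0 by apply: contrapT => vn; apply: xx; exists v.
    by rewrite (V0 (x - x')); exact: cl0.
  case: x0n => x0 x0n; have [a [a' [an an' E]]] := ore x0n wn wn'.
  exists (mulsc w a); first exact: (mulsc_nonnull x0n).
  rewrite (scalM actP) !(scalB actP) (E x').
  by apply: spanB; exact: span_scal.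
move=> q x [w wn sw]; exists [seq ((q^-1 * p.1)%g, p.2) | p <- w]; last first.
  move: sw; congr (span b); rewrite /scal big_map; apply: eq_bigr => p _.
  by rewrite -(actM actP) mulVKg.
move=> n; apply: wn => r; have := n (q^-1 * r)%g; rewrite /coef big_map /=.
by under eq_bigl do rewrite (inj_eq (mulgI _)).
Qed.

Lemma mem_cl b x : x \in b -> cl b x.
Proof. by move=> xb; apply: span_cl; exact: mem_span. Qed.

Lemma cl_scal b x w : ~ null_scalar w -> cl b (scal x w) -> cl b x.
Proof.
move=> wn [w' wn' sw]; have [->|/eqP xn] := eqVneq x 0; first exact: cl0.
by exists (mulsc w w'); [exact: (mulsc_nonnull xn) | rewrite (scalM actP)].
Qed.

Lemma cl_sub b s v : (forall x, x \in b -> cl s x) -> cl b v -> cl s v.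
Proof.
by move=> bs [w wn sw]; apply: cl_scal wn _; apply: sw => //; exact: submod_cl.
Qed.

Lemma cl_mono b s v : {subset b <= s} -> cl b v -> cl s v.
Proof. by move=> bs; apply: cl_sub => x /bs; exact: mem_cl. Qed.

Lemma cl_nil v : cl [::] v -> v = 0.
Proof.
move=> [w wn sw]; have /tf[//|//] : scal v w = 0.
by apply: (sw (fun v => v = 0)) => //; exact: submod0.
Qed.

Lemma indep_nil d : indep [::] d <-> free_seq act d.
Proof.
split=> -[ud H]; split=> // u; last by move/cl_nil; exact: H.
by move=> e; apply: H; rewrite e; exact: cl0.
Qed.

Lemma free_neq0 d x : free_seq act d -> x \in d -> x <> 0.
Proof.
move=> [ud ind] xd x0; pose u y : scalar Q := if y == x then [:: (1%g, 1)] else [::].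
apply: (@one_nonnull Q); have := ind u _ x xd; rewrite /u eqxx; apply.
apply: big1_seq => y _; case: eqP => [->|_]; last exact: scal_nil.
by rewrite x0 (scal0 actP).
Qed.

(** Multiplying each element of [d] by its denominator moves it into the span of [s], where
    [span_dependent] applies. *)
Lemma indep_le_span d s : indep [::] d -> (forall x, x \in d -> cl s x) ->
  (size d <= size s)%N.
Proof.
move=> /indep_nil[ud ind] ds; rewrite leqNgt; apply/negP => lt.
have : forall x, exists w, x \in d -> ~ null_scalar w /\ span s (scal x w).
  move=> x; have [/ds[w wn sw]|] := boolP (x \in d); first by exists w.
  by exists [::].
move=> /choice[w Hw].
have [x xd|u u0 [x xd xn]] := @span_dependent s d (fun x => scal x (w x)) ud lt.
  by have [] := Hw x xd.
have xn0 : x <> 0 by exact: free_neq0 (conj ud ind) xd.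
have [wn _] := Hw x xd; apply: (mulsc_nonnull xn0 wn xn).
apply: (ind (fun x => mulsc (w x) (u x))) => //.
by under eq_bigr do rewrite (scalM actP).
Qed.

Lemma indep_cons b d x : indep b d -> ~ cl (b ++ d) x -> indep b (x :: d).
Proof.
move=> [ud ind] xn; split.
  rewrite /= ud andbT; apply/negP => xd.
  by apply: xn; apply: mem_cl; rewrite mem_cat xd orbT.
move=> u; rewrite big_cons => H.
have ux : null_scalar (u x).
  apply: contrapT => un; apply: xn; apply: cl_scal un _.
  rewrite -[scal x _](addrK (\sum_(y <- d) scal y (u y))).
  apply: (submod_cl _).1.2; first by apply: cl_mono H => y; rewrite mem_cat => ->.
  apply: zclosed_sum; first exact: (submod_cl _).1.
  move=> y yd; apply: (@submod_scal (cl _)); first exact: submod_cl.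
  by apply: mem_cl; rewrite mem_cat yd orbT.
move=> y; rewrite inE => /predU1P[-> //|yd]; apply: ind yd.
by move: H; rewrite (scal_null _ _ ux) add0r.
Qed.

Lemma indep_maximal b s :
  exists d, [/\ {subset d <= s}, indep b d & forall x, x \in s -> cl (b ++ d) x].
Proof.
elim: s => [|x s [d [ds ind sd]]]; first by exists [::].
have [xd|xd] := pselect (cl (b ++ d) x).
  exists d; split=> // y; first by move/ds; rewrite inE orbC => ->.
  by rewrite inE => /predU1P[->|/sd].
exists (x :: d); split; last 2 first.
- exact: indep_cons.
- have sub : {subset b ++ d <= b ++ x :: d}.
    by move=> y; rewrite !mem_cat inE => /orP[->|->] //; rewrite !orbT.
  move=> y; rewrite inE => /predU1P[->|/sd].
    by apply: mem_cl; rewrite mem_cat mem_head orbT.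
  exact: cl_mono.
- by move=> y; rewrite !inE => /predU1P[->|/ds ->]; rewrite ?eqxx ?orbT.
Qed.

(** A maximal subfamily of [s] independent modulo [b] has, together with [b], all of [s] in its
    closure. *)
Lemma indep_le_relative b (m : nat) :
  (forall d, indep b d -> (size d <= m)%N) ->
  forall s, indep [::] s -> (size s <= size b + m)%N.
Proof.
move=> bd s inds; have [d [_ ind sd]] := indep_maximal b s.
apply: leq_trans (indep_le_span inds sd) _.
by rewrite size_cat leq_add2l bd.
Qed.

End Rank.

(** * Bound of a relative rank by the number of generators *)

Section GeneratorBound.
Local Open Scope ring_scope.
Variables (G Q : groupType) (V : zmodType) (act : Q -> V -> V).
Variables (p : G -> Q) (t : Q -> G) (nu : G -> V).
Hypothesis actP : module_action act.
Hypothesis folQ : folner Q.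
Hypothesis tf : forall (x : V) (u : scalar Q),
  scal act x u = 0 -> x = 0 \/ null_scalar u.
Hypothesis pM : {morph p : x y / (x * y)%g}.
Hypothesis tK : cancel t p.
Hypothesis nuM : forall g h, p g = 1%g -> p h = 1%g -> nu (g * h)%g = nu g + nu h.
Hypothesis nuJ : forall g h, p g = 1%g -> nu (g ^ h)%g = act (p h) (nu g).
Hypothesis nu_surj : forall v, exists2 g, p g = 1%g & nu g = v.
Variables (A0 : G -> Prop) (X : seq G) (b : seq V).
Hypothesis A0_subgroup : is_subgroup A0.
Hypothesis genG : forall S : set G, is_subgroup S ->
  (forall x, A0 x -> S x) -> (forall x, x \in X -> S x) -> S = setT.
Hypothesis A0b : forall a, A0 a -> p a = 1%g -> cl act b (nu a).

Let p1 : p 1%g = 1%g.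
Proof. by apply: (mulgI (p 1%g)); rewrite -pM !mulg1. Qed.
Let pV x : p x^-1%g = (p x)^-1%g.
Proof. by apply: (mulgI (p x)); rewrite -pM !mulgV. Qed.
Let A0V a : A0 a -> A0 a^-1%g.
Proof. by rewrite -[a^-1%g]mul1g; apply: A0_subgroup.2; exact: A0_subgroup.1. Qed.
Let A0M a a' : A0 a -> A0 a' -> A0 (a * a')%g.
Proof. by move=> Aa Aa'; rewrite -[a']invgK; apply: A0_subgroup.2 => //; exact: A0V. Qed.

(** Orbits of left multiplication by the image of [A0]; the section of [p] is built orbit by
    orbit. *)
Let orbit q : set Q := [set r | exists2 a, A0 a & q = (p a * r)%g].
Let rep q : Q := xget 1%g (orbit q).

Let repP q : exists2 a, A0 a & q = (p a * rep q)%g.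
Proof.
apply: (@xgetPex _ 1%g (orbit q)); exists q, 1%g; first exact: A0_subgroup.1.
by rewrite p1 mul1g.
Qed.

Let rep_orbit a q : A0 a -> rep (p a * q)%g = rep q.
Proof.
move=> Aa; rewrite /rep; congr xget; apply/seteqP; split=> r [a' Aa' E].
  exists (a^-1 * a')%g; first by apply: A0M => //; exact: A0V.
  by rewrite pM pV -mulgA -E mulKg.
by exists (a * a')%g; [exact: A0M | rewrite E mulgA pM].
Qed.

Let alpha q : G := xget 1%g [set a | A0 a /\ q = (p a * rep q)%g].
Let alphaP q : A0 (alpha q) /\ q = (p (alpha q) * rep q)%g.
Proof.
apply: (@xgetPex _ 1%g [set a | A0 a /\ q = (p a * rep q)%g]).
by have [a Aa E] := repP q; exists a.
Qed.

(* A section of p that commutes with the left action of A0 up to A0. *)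
Let sigma q : G := (alpha q * t (rep q))%g.
Let sigmaK q : p (sigma q) = q.
Proof. by rewrite pM tK -(alphaP q).2. Qed.

(** The kernel element determined by $g\,\sigma(q) = \sigma(p(g)q)\,c(g,q)$. *)
Let cocycle g q : G := ((sigma (p g * q))^-1 * (g * sigma q))%g.
Let p_cocycle g q : p (cocycle g q) = 1%g.
Proof. by rewrite /cocycle pM (pM g) pV !sigmaK mulVg. Qed.

Let cocycleM g h q :
  nu (cocycle (g * h) q) = nu (cocycle g (p h * q)%g) + nu (cocycle h q).
Proof.
rewrite -nuM ?p_cocycle //; congr nu.
by rewrite /cocycle pM -(mulgA (p g)); move: sigma => s; rewrite !mulgA mulgK.
Qed.

Let nu1 : nu 1%g = 0.
Proof. by have := nuM p1 p1; rewrite mulg1 -[LHS]addr0 => /addrI. Qed.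

Let cocycle1 q : nu (cocycle 1%g q) = 0.
Proof. by rewrite /cocycle p1 !mul1g mulVg nu1. Qed.

(** Multiplication by [p a] keeps the orbit representative, so the value is a conjugate of an
    element of [A0] in the kernel of [p], and [nu] sends that element into [cl b]. *)
Let cocycle_A0 a q : A0 a -> cl act b (nu (cocycle a q)).
Proof.
move=> Aa; pose c := ((alpha (p a * q))^-1 * (a * alpha q))%g.
have pc : p c = 1%g.
  have Ea r : p (alpha r) = (r * (rep r)^-1)%g by rewrite {2}(alphaP r).2 mulgK.
  by rewrite /c pM (pM a) pV !Ea rep_orbit // (mulgA (p a)) mulVg.
have -> : cocycle a q = (c ^ t (rep q))%g.
  by rewrite /cocycle /sigma rep_orbit // conjgE /c invgM !mulgA.
rewrite nuJ //; apply: (submod_cl actP folQ tf b).2; apply: A0b => //.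
apply: A0M; first by apply: A0V; exact: (alphaP _).1.
by apply: A0M => //; exact: (alphaP _).1.
Qed.

(* By telescoping over a word for g, the translates of nu g lie modulo cl b in
   the group generated by the values of the cocycle at X. *)
Lemma indep_generators d : indep act b d -> (size d <= size X)%N.
Proof.
move=> [ud ind]; rewrite leqNgt; apply/negP => lt.
have Wz := (submod_cl actP folQ tf b).1.
pose y (i : 'I_(size X)) q := nu (cocycle X`_i q).
(* [P g] says that, modulo [cl b], the value at $(g,q)$ is generated by the values of the cocycle of
   the generators over $\kappa q$. The cocycle identity makes such [g] a subgroup. *)
pose P (g : G) := exists kappa : seq Q, forall q T, uniq T ->
  (forall k, k \in kappa -> (k * q)%g \in T) ->
  zspan (cl act b) y T (nu (cocycle g q)).
have PV g : P g -> P g^-1%g.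
  move=> [K HK]; exists [seq (k * (p g)^-1)%g | k <- K] => q T uT kT.
  have E := cocycleM g g^-1%g q; rewrite mulgV cocycle1 in E.
  have -> : nu (cocycle g^-1 q) = - nu (cocycle g (p g^-1 * q)%g).
    by apply/esym/eqP; rewrite -subr_eq0 -opprD -E oppr0.
  apply: (zclosedN (zspan_closed y Wz T)); apply: HK => // k kK.
  by rewrite pV mulgA; apply: kT; exact: (map_f (fun k => k * (p g)^-1)%g).
have PT : P = setT.
  apply: genG.
  - split; first by exists [::] => q T uT _; rewrite cocycle1; exact: (zspan_closed y Wz T).1.
    move=> g h Pg /PV[K' HK']; case: Pg => K HK.
    exists ([seq (k * p h^-1)%g | k <- K] ++ K') => q T uT kT; rewrite cocycleM.
    apply: (zclosedD (zspan_closed y Wz T)).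
      apply: HK => // k kK; rewrite mulgA; apply: kT.
      by rewrite mem_cat (map_f (fun k => k * p h^-1)%g).
    by apply: HK' => // k kK; apply: kT; rewrite mem_cat kK orbT.
  - by move=> a Aa; exists [::] => q T uT _; apply: zspan_sub; exact: cocycle_A0.
  - move=> x xX; have lt' : (index x X < size X)%N by rewrite index_mem.
    exists [:: 1%g] => q T uT kT.
    have -> : cocycle x q = cocycle X`_(Ordinal lt') q by rewrite /= nth_index.
    by apply: zspan_gen => //; rewrite -[q]mul1g kT ?mem_head.
have [|u [Wu [x xd xn]]] := counting (act := act) folQ (y := y) (e := id) Wz ud lt; last first.
  by apply: xn; exact: ind xd.
move=> x _; have [g pg <-] := nu_surj x.
have [K HK] : P g by rewrite PT.
exists K => q T uT kT; have := HK q T uT kT.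
(* On the kernel of [p] the cocycle at [q] is conjugation by $\sigma(q)$, so its image under [nu] is
   the translate of [nu g] by [q]. *)
by rewrite /cocycle pg mul1g -[(_^-1 * _)%g]conjgE nuJ // sigmaK.
Qed.

End GeneratorBound.

(** * Cosets of a normal subgroup *)

Section NormalQuotient.
Local Open Scope group_scope.
Variables (G : groupType) (N : normalSubgroup G).

Lemma coset_pi1 : coset_pi N 1 = 1. Proof. by []. Qed.

Lemma coset_pi_eq1 x : coset_pi N x = 1 <-> N x.
Proof.
rewrite -coset_pi1 coset_piP; split=> [/nsubV|Nx].
  by rewrite invgM invgK invg1 mul1g.
by rewrite mulg1; exact: nsubV.
Qed.

Lemma coset_piV x : coset_pi N x^-1 = (coset_pi N x)^-1.
Proof. exact: gmulfV. Qed.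

Lemma coset_piJ x y : coset_pi N (x ^ y) = coset_pi N x ^ coset_pi N y.
Proof. by rewrite !conjgE !coset_piM coset_piV. Qed.

Lemma coset_pi_repr (c : quotientGroup N) : coset_pi N (repr c) = c.
Proof. exact: reprK. Qed.

End NormalQuotient.

(** * Abelian factors as modules *)

Section FactorModule.
Local Open Scope group_scope.

Variables (G : groupType) (N M : normalSubgroup G).
Local Notation factor := (@Defs.factor G N M).

(** The proof of commutativity is a parameter of the type so that the additive group structure can
    be attached to it. *)
Definition factor_module of abelian_factor N M : Type :=
  {x : quotientGroup M | `[< factor x >]}.

Lemma factor1 : factor 1.
Proof. by exists 1; [exact: nsub1 | exact: coset_pi1]. Qed.

Lemma factorM x y : factor x -> factor y -> factor (x * y).
Proof.
move=> [g Ng <-] [h Nh <-]; exists (g * h); first exact: nsubM.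
exact: coset_piM.
Qed.

Lemma factorV x : factor x -> factor x^-1.
Proof.
by move=> [g Ng <-]; exists g^-1; [exact: nsubV | exact: coset_piV].
Qed.

Lemma factorJ x g : factor x -> factor (x ^ coset_pi M g).
Proof.
move=> [h Nh <-]; exists (h ^ g); first exact: nsub_conj.
exact: coset_piJ.
Qed.

Variable ab : abelian_factor N M.
Local Notation V := (factor_module ab).

HB.instance Definition _ := [Choice of V by <:].
HB.instance Definition _ := [isSub of V for sval].

Definition to_module x (Fx : factor x) : V := exist _ x (asboolT Fx).

Lemma factorP (v : V) : factor (sval v).
Proof. exact/asboolP/(svalP v). Qed.

Let add (v w : V) : V := to_module (factorM (factorP v) (factorP w)).
Let opp (v : V) : V := to_module (factorV (factorP v)).
Let zero : V := to_module factor1.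

Let addA : associative add.
Proof. by move=> u v w; apply: val_inj; rewrite /= mulgA. Qed.
Let addC : commutative add.
Proof.
by move=> v w; apply: val_inj; apply: ab; apply/mem_set; exact: factorP.
Qed.
Let add0 : left_id zero add.
Proof. by move=> v; apply: val_inj; rewrite /= mul1g. Qed.
Let addN : left_inverse zero opp add.
Proof. by move=> v; apply: val_inj; rewrite /= mulVg. Qed.

HB.instance Definition _ := GRing.isZmodule.Build V addA addC add0 addN.

Lemma sval_add (v w : V) : sval (v + w)%R = sval v * sval w. Proof. by []. Qed.
Lemma sval_zero : sval (0%R : V) = 1. Proof. by []. Qed.
Lemma sval_opp (v : V) : sval (- v)%R = (sval v)^-1. Proof. by []. Qed.
Lemma factor_val_inj : injective (fun v : V => sval v). Proof. exact: val_inj. Qed.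

Lemma sval_sum (I : Type) (r : seq I) (F : I -> V) :
  sval (\sum_(i <- r) F i)%R = \prod_(i <- r) sval (F i).
Proof. exact: (big_morph (fun v : V => sval v) sval_add sval_zero). Qed.

Lemma sval_mulz (v : V) (z : int) : sval (v *~ z)%R = zpower (sval v) z.
Proof.
have H n : sval (v *+ n)%R = sval v ^+ n.
  by elim: n => [|n IH] //; rewrite mulrS expgS sval_add IH.
by case: z => n; [exact: H | rewrite NegzE mulrNz sval_opp -pmulrn H].
Qed.

Definition factor_conj (c : quotientGroup N) (v : V) : V :=
  to_module (factorJ (repr c) (factorP v)).

(* Junk value 0 outside N M. *)
Definition factor_class (g : G) : V := insubd (0%R : V) (coset_pi M g).

Lemma sval_class g : N g -> sval (factor_class g) = coset_pi M g.
Proof. by move=> Ng; apply: insubdK; apply/asboolP; exists g. Qed.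

Lemma factor_class_surj v : exists2 g, N g & factor_class g = v.
Proof.
have [g Ng E] := factorP v; exists g => //.
by apply: factor_val_inj; rewrite /= sval_class.
Qed.

(** Two representatives of a coset differ by an element of [N], and [N] acts trivially by
    conjugation on the abelian factor. *)
Lemma factor_conj_coset (g : G) (v : V) :
  sval (factor_conj (coset_pi N g) v) = sval v ^ coset_pi M g.
Proof.
rewrite /=; set r := repr _.
have Nr : N (g * r^-1).
  have /(nsub_conj r^-1) : N (r^-1 * g) by apply/coset_piP; exact: reprK.
  by rewrite conjgE invgK !mulgA mulgV mul1g.
have [h Nh <-] := factorP v; rewrite -!coset_piJ.
have -> : h ^ g = (h ^ (g * r^-1)) ^ r by rewrite -conjgM -mulgA mulVg mulg1.
rewrite [LHS]coset_piJ [RHS]coset_piJ; congr (_ ^ _).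
rewrite coset_piJ conjgE.
have -> : coset_pi M h * coset_pi M (g * r^-1) = coset_pi M (g * r^-1) * coset_pi M h.
  by apply: ab; apply/mem_set; [exists h | exists (g * r^-1)].
by rewrite mulKg.
Qed.

Lemma factor_conj_action : module_action factor_conj.
Proof.
split.
- by move=> q v w; apply: factor_val_inj; rewrite /= conjMg conjVg.
- by move=> v; apply: factor_val_inj; rewrite -coset_pi1 factor_conj_coset conjg1.
- move=> q r v; apply: factor_val_inj; rewrite -(coset_pi_repr q) -(coset_pi_repr r).
  by rewrite -coset_piM !factor_conj_coset coset_piM conjgM.
Qed.

Lemma factor_classM g h : N g -> N h ->
  factor_class (g * h) = (factor_class g + factor_class h)%R.
Proof.
move=> Ng Nh; apply: factor_val_inj.
by rewrite sval_add !sval_class ?coset_piM //; exact: nsubM.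
Qed.

Lemma factor_classJ g h : N g ->
  factor_class (g ^ h) = factor_conj (coset_pi N h) (factor_class g).
Proof.
move=> Ng; apply: factor_val_inj; rewrite factor_conj_coset !sval_class ?coset_piJ //.
exact: nsub_conj.
Qed.

Lemma factor_class_eq0 g : N g -> factor_class g = 0%R <-> M g.
Proof.
move=> Ng; rewrite -coset_pi_eq1 -sval_class //.
by split=> [->|E] //; exact: factor_val_inj.
Qed.

(** * Finitely supported functions versus lists of terms, and ranks of factors *)

Section GroupRing.
Local Notation Q := (quotientGroup N).

Definition to_scalar (f : groupRing Q) : scalar Q := [seq (c, f c) | c <- finsupp f].

Definition of_scalar (u : scalar Q) : groupRing Q :=
  [fsfun c in seq_fset tt (map fst u) => coef u c].

Lemma coef_to_scalar f c : coef (to_scalar f) c = f c.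
Proof. by rewrite coef_map ?fset_uniq //; case: finsuppP. Qed.

Lemma of_scalarE u c : of_scalar u c = coef u c.
Proof.
rewrite fsfunE seq_fsetE; case: ifPn => // cu.
rewrite /coef big1_seq // => p /andP[/eqP pc pu].
by move: cu; rewrite -pc map_f.
Qed.

Lemma null_to_scalar f : null_scalar (to_scalar f) <-> f = [fsfun].
Proof.
split=> [H|-> c]; last by rewrite coef_to_scalar fsfunE.
by apply/fsfunP => c; rewrite -coef_to_scalar H fsfunE.
Qed.

Lemma of_scalar_null u : of_scalar u = [fsfun] -> null_scalar u.
Proof. by move=> H c; rewrite -of_scalarE H fsfunE. Qed.

Lemma factor_actE (v : V) f :
  factor_act (sval v) f = sval (scal factor_conj v (to_scalar f)).
Proof.
rewrite /scal big_map sval_sum; apply: eq_bigr => c _.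
by rewrite sval_mulz.
Qed.

Lemma scal_of_scalar (v : V) u :
  scal factor_conj v (to_scalar (of_scalar u)) = scal factor_conj v u.
Proof.
apply/eqP; rewrite -subr_eq0 -scal_opp -scal_cat; apply/eqP.
apply: scal_null => c.
by rewrite coef_cat coef_opp coef_to_scalar of_scalarE subrr.
Qed.

Lemma torsion_free_factorP : torsion_free_factor N M <->
  forall (v : V) u, scal factor_conj v u = 0%R -> v = 0%R \/ null_scalar u.
Proof.
split=> [tf v u e|tf x f Fx e].
  have : factor_act (sval v) (of_scalar u) = 1 by rewrite factor_actE scal_of_scalar e.
  move=> /(tf _ _ (factorP v))[v1|]; last by right; exact: of_scalar_null.
  by left; exact: factor_val_inj.
have : scal factor_conj (to_module Fx) (to_scalar f) = 0%R.
  by apply: factor_val_inj; rewrite -factor_actE.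
move=> /tf[/(congr1 sval) //|]; first by left.
by right; exact/null_to_scalar.
Qed.

Local Notation indep0 := (free_seq factor_conj).

Lemma lin_indepP (B : set (quotientGroup M)) : lin_indep N B <->
  (B `<=` factor)%classic /\
  forall s : seq V, uniq s -> (forall x, x \in s -> B (sval x)) -> indep0 s.
Proof.
split=> -[BF HB]; split=> // s.
  move=> us sB; split=> // u e x xs.
  apply: of_scalar_null.
  have := HB (map sval s) (fun y => of_scalar (u (insubd (0%R : V) y))) _ _ _ (sval x).
  rewrite -[insubd _ _]/(insubd _ (val x)) valKd; apply.
  - by rewrite (map_inj_uniq val_inj).
  - by move=> _ /mapP[y ys ->]; exact: sB.
  - rewrite big_map; apply: etrans (congr1 sval e); rewrite sval_sum; apply: eq_bigr => y _.
    by rewrite -[insubd _ _]/(insubd _ (val y)) valKd factor_actE scal_of_scalar.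
  - by rewrite (mem_map val_inj).
move=> u us sB e x xs; apply/null_to_scalar.
pose s' : seq V := map (insubd (0%R : V)) s.
have sK y : y \in s -> sval (insubd (0%R : V) y) = y.
  by move=> ys; apply: (@insubdK _ _ V); apply/asboolP; apply: BF; exact: sB.
have [] : indep0 s'.
  apply: HB; last by move=> _ /mapP[y ys ->]; rewrite sK //; exact: sB.
  rewrite map_inj_in_uniq // => y z ys zs /(congr1 sval); by rewrite !sK.
move=> _ /(_ (fun v => to_scalar (u (sval v)))) H.
have := H _ (insubd (0%R : V) x) _; rewrite sK //; apply; last exact: map_f.
apply: factor_val_inj; rewrite sval_sum big_map; apply: etrans e.
by rewrite big_seq [RHS]big_seq; apply: eq_bigr => y ys; rewrite -factor_actE sK.
Qed.

Lemma indep0_sub (s t : seq V) : indep0 s -> uniq t -> {subset t <= s} -> indep0 t.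
Proof.
move=> [us ind] ut ts; split=> // u e x xt.
have := ind (fun y => if y \in t then u y else [::]) _ x (ts x xt).
rewrite xt; apply; rewrite -[RHS]e.
rewrite (bigID (mem t)) /= [X in (_ + X)%R]big1 ?addr0; last first.
  by move=> y /negPf ->; rewrite scal_nil.
rewrite -big_filter (perm_big t) /=; last first.
  apply: uniq_perm; rewrite ?filter_uniq // => y; rewrite mem_filter.
  by apply/andP/idP => [[]|yt] //; split=> //; exact: ts.
by rewrite big_seq [RHS]big_seq; apply: eq_bigr => y ->.
Qed.

Hypothesis folQ : folner Q.
Hypothesis tfN : torsion_free_factor N M.
Let tf := torsion_free_factorP.1 tfN.

Lemma indep0P (s : seq V) : indep0 s <-> indep factor_conj [::] s.
Proof. by apply: iff_sym; exact: (indep_nil factor_conj_action tf). Qed.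

(* A basis of the vector space obtained by inverting the nonzero scalars. *)
Definition has_rank (r : nat) : Prop := exists s : seq V,
  [/\ size s = r, indep0 s & forall x, cl factor_conj s x].

Lemma has_rank_le r s : has_rank r -> indep0 s -> (size s <= r)%N.
Proof.
move=> [b [<- _ bV]] /indep0P inds.
by apply: (indep_le_span factor_conj_action folQ tf inds).
Qed.

(** A finite maximal independent set has the whole factor in its closure, since an element outside
    could be adjoined. Conversely, [has_rank_le] prevents a basis from having a larger independent
    set above it. *)
Lemma is_factor_rankP r : is_factor_rank N M r <-> has_rank r.
Proof.
split=> [[B [/lin_indepP[BF HB] maxB]]|[s [<- inds sV]]].
  move=> Br; have finB : finite_set B by apply/finite_setP; exists r.
  have [X BX] := (finite_fsetP.1 finB).
  have Xr : size X = r by apply/card_eq_fsetP; rewrite -BX.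
  have memX y : B y <-> y \in X by rewrite BX.
  (* Every element of [X] lies in the factor, so the default value of [insubd] is never taken. *)
  pose s : seq V := map (insubd (0%R : V)) X.
  have sK y : y \in X -> sval (insubd (0%R : V) y) = y.
    by move=> yX; apply: (@insubdK _ _ V); apply/asboolP; apply: BF; exact/memX.
  have memS v : v \in s <-> B (sval v).
    rewrite memX; split=> [/mapP[y yX ->]|vX]; first by rewrite sK.
    by rewrite -(valKd (0%R : V) v); exact: map_f.
  have us : uniq s.
    rewrite map_inj_in_uniq ?fset_uniq // => y z ys zs /(congr1 sval); by rewrite !sK.
  have inds : indep0 s by apply: HB => // x /memS.
  exists s; split; [by rewrite size_map | by [] |] => x.
  apply: contrapT => xn; have /indep0P inds' := inds.
  have : indep factor_conj [::] (x :: s).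
    exact: (indep_cons factor_conj_action folQ tf inds').
  move=> /indep0P indxs; apply: xn.
  pose C : set (quotientGroup M) := [set y | B y \/ y = sval x]%classic.
  have CB : C = B.
    apply: maxB; last by move=> y; left.
    apply/lin_indepP; split=> [y [/BF //|->]|t ut tC]; first exact: factorP.
    apply: (indep0_sub indxs ut) => v /tC[/memS vs|/factor_val_inj ->].
      by rewrite inE vs orbT.
    exact: mem_head.
  apply: (mem_cl factor_conj_action); apply/memS; rewrite -CB; by right.
exists [set` map sval s]%classic; split.
- apply/lin_indepP; split=> [_ /= /mapP[v vs ->]|t ut ts]; first exact: factorP.
  by apply: (indep0_sub inds ut) => v /ts /=; rewrite (mem_map val_inj).
- move=> C /lin_indepP[CF HC] sC; apply/seteqP; split=> // y Cy /=.
  pose v := to_module (CF _ Cy); have yv : y = sval v by [].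
  rewrite yv (mem_map val_inj); apply: contrapT => /negP vs.
  have indvs : indep0 (v :: s).
    apply: HC; first by rewrite /= vs inds.1.
    move=> w; rewrite inE => /predU1P[->|ws]; first by rewrite -yv.
    by apply: sC; rewrite /= (mem_map val_inj).
  have : (size (v :: s) <= size s)%N by apply: has_rank_le indvs; exists s.
  by rewrite ltnn.
- rewrite -[X in [set` X]%classic]/(map sval s).
  have -> : [set` map sval s]%classic = [set` seq_fset tt (map sval s)]%classic.
    apply/predeqP => y; have E := seq_fsetE tt (map sval s) y.
    by split=> [|]; [rewrite -[X in X -> _]/(is_true (y \in map sval s)) -E
      | rewrite -[X in X -> _]/(is_true (y \in seq_fset tt (map sval s))) E].
  apply/card_eq_fsetP; rewrite size_seq_fset undup_id ?size_map //.
  by rewrite (map_inj_uniq val_inj) inds.1.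
Qed.

(** An independent sequence of the greatest length is a basis. *)
Lemma bounded_has_rank k : (forall s, indep0 s -> (size s <= k)%N) ->
  exists2 r, has_rank r & (r <= k)%N.
Proof.
move=> bd; pose P r := `[< exists2 s, indep0 s & size s = r >].
have exP : exists r, P r by exists 0%N; apply/asboolP; exists [::].
have ubP r : P r -> (r <= k)%N by move=> /asboolP[s inds <-]; exact: bd.
case: (ex_maxnP exP ubP) => r /asboolP[s inds sr] maxr.
exists r; last by rewrite -sr bd.
exists s; split=> // x; apply: contrapT => xn.
have /indep0P inds' := inds.
have /indep0P indxs := indep_cons factor_conj_action folQ tf inds' xn.
have : (size (x :: s) <= r)%N by apply: maxr; apply/asboolP; exists (x :: s).
by rewrite /= sr ltnn.
Qed.

Lemma has_rank_uniq r r' : has_rank r -> has_rank r' -> r = r'.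
Proof.
move=> Hr Hr'; have [s [sr inds _]] := Hr; have [s' [sr' inds' _]] := Hr'.
have := has_rank_le Hr' inds; have := has_rank_le Hr inds'; rewrite sr sr'; lia.
Qed.

End GroupRing.

End FactorModule.

(** * Semilinear maps and transfer of independence *)

Section Semilinear.
Local Open Scope ring_scope.
Variables (Q Q' : groupType) (V V' : zmodType).
Variables (act : Q -> V -> V) (act' : Q' -> V' -> V').

Definition map_scalar (f : Q -> Q') (u : scalar Q) : scalar Q' :=
  [seq (f p.1, p.2) | p <- u].

Definition semilinear (phi : V -> V') (psi : Q -> Q') : Prop :=
  (forall x y, phi (x - y) = phi x - phi y) /\
  (forall q x, phi (act q x) = act' (psi q) (phi x)).

(** Injectivity on the support prevents terms at different group elements from merging and
    cancelling. *)
Lemma null_map_scalar (f : Q -> Q') (u : scalar Q) :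
  {in map fst u &, injective f} -> null_scalar (map_scalar f u) -> null_scalar u.
Proof.
move=> finj nfu q; have [qu|qu] := boolP (q \in map fst u); last first.
  by rewrite /coef big1_seq // => p /andP[/eqP pq pu]; move: qu; rewrite -pq map_f.
rewrite -(nfu (f q)) /coef big_map big_seq_cond [RHS]big_seq_cond.
apply: eq_bigl => p /=; have [pu|//] := boolP (p \in u).
by rewrite /=; apply/eqP/eqP => [-> //|e]; apply: finj => //; exact: map_f.
Qed.

Section Map.
Variables (phi : V -> V') (psi : Q -> Q').
Hypothesis slin : semilinear phi psi.

Lemma semilinear0 : phi 0 = 0.
Proof. by rewrite -[X in phi X](subrr 0) slin.1 subrr. Qed.

Lemma semilinearN x : phi (- x) = - phi x.
Proof. by rewrite -sub0r slin.1 semilinear0 sub0r. Qed.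

Lemma semilinearD x y : phi (x + y) = phi x + phi y.
Proof. by rewrite -[y]opprK slin.1 !semilinearN. Qed.

Lemma semilinear_sum (I : Type) (r : seq I) (F : I -> V) :
  phi (\sum_(i <- r) F i) = \sum_(i <- r) phi (F i).
Proof. exact: (big_morph phi semilinearD semilinear0). Qed.

Lemma semilinearMz x (z : int) : phi (x *~ z) = phi x *~ z.
Proof.
have H n : phi (x *+ n) = phi x *+ n.
  by elim: n => [|n IH]; rewrite ?semilinear0 // !mulrS semilinearD IH.
case: z => n; first exact: H.
by rewrite NegzE !mulrNz semilinearN -!pmulrn H.
Qed.

Lemma semilinear_scal x u : phi (scal act x u) = scal act' (phi x) (map_scalar psi u).
Proof.
rewrite semilinear_sum /scal big_map; apply: eq_bigr => p _.
by rewrite semilinearMz slin.2.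
Qed.

Lemma semilinear_inj : (forall x, phi x = 0 -> x = 0) -> injective phi.
Proof.
move=> ker x y /eqP; rewrite -subr_eq0 -slin.1 => /eqP/ker/eqP.
by rewrite subr_eq0 => /eqP.
Qed.

Lemma semilinear_cl b v : injective psi -> cl act b v ->
  cl act' (map phi b) (phi v).
Proof.
move=> psi_inj [w wn sw]; exists (map_scalar psi w).
  by move=> /null_map_scalar H; apply: wn; apply: H => ? ? _ _; exact: psi_inj.
rewrite -semilinear_scal; have SS := submod_span act' (map phi b).
apply: (sw (fun v => span act' (map phi b) (phi v))).
  split; first split; first by rewrite semilinear0; exact: SS.1.1.
    by move=> x y; rewrite slin.1; exact: SS.1.2.
  by move=> q x; rewrite slin.2; exact: SS.2.
by move=> x xb; apply: mem_span; exact: map_f.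
Qed.

End Map.

Lemma free_reflect_relation (phi : V -> V') (psi : Q -> Q') (s : seq V)
    (u : V -> scalar Q) :
  semilinear phi psi ->
  {in flatten [seq map fst (u x) | x <- s] &, injective psi} ->
  free_seq act' (map phi s) -> uniq s ->
  phi (\sum_(x <- s) scal act x (u x)) = 0 -> forall x, x \in s -> null_scalar (u x).
Proof.
move=> slin psi_inj [uphi ind] us u0 x xs; apply: (@null_map_scalar psi).
  have sub y : y \in map fst (u x) -> y \in flatten [seq map fst (u x) | x <- s].
    by move=> yu; apply/flatten_mapP; exists x.
  by move=> y z /sub yT /sub zT; exact: psi_inj.
pose v y := map_scalar psi (u (nth 0 s (index y (map phi s)))).
have vE y : y \in s -> v (phi y) = map_scalar psi (u y).
  move=> ys; have lt : (index y s < size s)%N by rewrite index_mem.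
  rewrite /v -[in index _ _](nth_index 0 ys) -(nth_map 0 0 phi lt).
  by rewrite index_uniq ?size_map // nth_index.
have := ind v _ (phi x) (map_f _ xs); rewrite vE //; apply.
rewrite big_map big_seq.
under eq_bigr => y ys do rewrite vE // -(semilinear_scal slin).
by rewrite -big_seq -(semilinear_sum slin) u0.
Qed.

(** The maps may depend on [T]: a relation has finite support, and discrimination gives retractions
    injective on prescribed finite sets. *)
Lemma free_reflect (s : seq V) : uniq s ->
  (forall T : seq Q, exists phi psi,
    [/\ semilinear phi psi, {in T &, injective psi} & free_seq act' (map phi s)]) ->
  free_seq act s.
Proof.
move=> us H; split=> // u u0.
have [phi [psi [slin psi_inj fs]]] := H (flatten [seq map fst (u x) | x <- s]).
by apply: (free_reflect_relation slin psi_inj fs us); rewrite u0 (semilinear0 slin).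
Qed.

Lemma torsion_free_reflect :
  (forall (x : V') u, scal act' x u = 0 -> x = 0 \/ null_scalar u) ->
  (forall (x : V) (T : seq Q), x <> 0 -> exists phi psi,
    [/\ semilinear phi psi, {in T &, injective psi} & phi x <> 0]) ->
  forall (x : V) u, scal act x u = 0 -> x = 0 \/ null_scalar u.
Proof.
move=> tf H x u e; have [->|/eqP xn] := eqVneq x 0; first by left.
right; have [phi [psi [slin psi_inj phix]]] := H x (map fst u) xn.
apply: (@null_map_scalar psi) => //.
have /tf[//|//] : scal act' (phi x) (map_scalar psi u) = 0.
by rewrite -(semilinear_scal slin) e (semilinear0 slin).
Qed.

End Semilinear.

Section SemilinearImage.
Local Open Scope ring_scope.
Variables (Q Q' : groupType) (V V' : zmodType).
Variables (act : Q -> V -> V) (act' : Q' -> V' -> V').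

(** The coefficients of a relation in the image are pulled back along the right inverse [psi'], and
    the relation itself by injectivity of [phi]. *)
Lemma free_image (phi : V -> V') (psi : Q -> Q') (psi' : Q' -> Q) (s : seq V) :
  semilinear act act' phi psi -> injective phi -> cancel psi' psi ->
  free_seq act s -> free_seq act' (map phi s).
Proof.
move=> slin phi_inj psiK [us ind]; split; first by rewrite map_inj_uniq.
move=> u u0 _ /mapP[x xs ->].
apply: (@null_map_scalar _ _ psi'); first by move=> ? ? _ _; exact: (can_inj psiK).
apply: (ind (fun y => map_scalar psi' (u (phi y))) _ x xs); apply: phi_inj.
rewrite (semilinear_sum slin) (semilinear0 slin) -[RHS]u0 big_map.
apply: eq_bigr => y _; rewrite (semilinear_scal slin); congr scal.
rewrite /map_scalar -map_comp -[RHS]map_id; apply: eq_map => p /=.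
by rewrite psiK -surjective_pairing.
Qed.

End SemilinearImage.

(** * Maps of factors induced by homomorphisms *)

Section FactorMaps.
Local Open Scope group_scope.

(** The cocycle bound for the projection onto $G/N$, with [repr] as section and the class in $N/M$
    as [nu], added to the size of [b]. *)
Lemma factor_generators (G : groupType) (N M : normalSubgroup G)
    (ab : abelian_factor N M) (A0 : G -> Prop) (X : seq G)
    (b s : seq (factor_module ab)) :
  folner (quotientGroup N) -> torsion_free_factor N M -> is_subgroup A0 ->
  (forall S : set G, is_subgroup S -> (forall x, A0 x -> S x) ->
     (forall x, x \in X -> S x) -> S = setT) ->
  (forall a, A0 a -> N a -> cl (@factor_conj _ _ _ ab) b (factor_class ab a)) ->
  free_seq (@factor_conj _ _ _ ab) s -> (size s <= size b + size X)%N.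
Proof.
move=> folQ /(torsion_free_factorP ab) tf A0s gen A0b.
move=> /(indep_nil (factor_conj_action ab) tf) inds.
apply: (indep_le_relative (factor_conj_action ab) folQ tf _ inds) => d.
apply: (@indep_generators _ _ _ _ (coset_pi N) (repr : quotientGroup N -> G)
  (factor_class ab) (factor_conj_action ab) folQ tf _ _ _ _ _ A0 X b A0s gen).
- exact: coset_piM.
- exact: coset_pi_repr.
- by move=> g h /coset_pi_eq1 Ng /coset_pi_eq1 Nh; exact: factor_classM.
- by move=> g h /coset_pi_eq1 Ng; exact: factor_classJ.
- by move=> v; have [g Ng <-] := factor_class_surj v; exists g => //; apply/coset_pi_eq1.
- by move=> a Aa /coset_pi_eq1 Na; exact: A0b.
Qed.

Section Induced.
Variables (G G' : groupType) (N M : normalSubgroup G) (N' M' : normalSubgroup G').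
Variables (ab : abelian_factor N M) (ab' : abelian_factor N' M') (f : {hom G -> G'}).
Hypotheses (fN : forall g, N g -> N' (f g)) (fM : forall g, N g -> M g -> M' (f g)).

Definition quotient_map (c : quotientGroup N) : quotientGroup N' :=
  coset_pi N' (f (repr c)).

Definition factor_lift (v : factor_module ab) : G :=
  xget 1 [set g | N g /\ factor_class ab g = v]%classic.

Definition factor_map (v : factor_module ab) : factor_module ab' :=
  factor_class ab' (f (factor_lift v)).

Lemma factor_liftP v : N (factor_lift v) /\ factor_class ab (factor_lift v) = v.
Proof.
apply: (@xgetPex _ 1 [set g | N g /\ factor_class ab g = v]%classic).
by have [g Ng E] := factor_class_surj v; exists g.
Qed.

Lemma quotient_map_coset g : quotient_map (coset_pi N g) = coset_pi N' (f g).
Proof.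
apply/coset_piP; rewrite -gmulfV -gmulfM; apply: fN; apply/coset_piP.
exact: coset_pi_repr.
Qed.

Lemma factor_classV (g : G) : N g -> factor_class ab g^-1 = (- factor_class ab g)%R.
Proof.
move=> Ng; apply: factor_val_inj.
by rewrite sval_opp !sval_class ?coset_piV //; exact: nsubV.
Qed.

(** Two lifts of a class differ by an element of [M], which [f] sends into [M'], so the choice made
    by [factor_lift] is immaterial. *)
Lemma factor_map_class g : N g -> factor_map (factor_class ab g) = factor_class ab' (f g).
Proof.
move=> Ng; have [Nl El] := factor_liftP (factor_class ab g).
rewrite /factor_map; move: (factor_lift _) Nl El => l Nl El.
have Nlg : N (l * g^-1) by apply: nsubM => //; exact: nsubV.
have Mlg : M (l * g^-1).
  apply/(factor_class_eq0 ab Nlg).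
  by rewrite factor_classM ?factor_classV ?El ?subrr //; exact: nsubV.
have -> : f l = f (l * g^-1) * f g by rewrite -gmulfM mulgVK.
have N'lg := fN Nlg; rewrite factor_classM //; last exact: fN.
by rewrite (factor_class_eq0 ab' N'lg).2 ?add0r //; exact: fM.
Qed.

Lemma factor_map_semilinear :
  semilinear (@factor_conj _ _ _ ab) (@factor_conj _ _ _ ab') factor_map quotient_map.
Proof.
split=> [v w|c v].
  have [g Ng <-] := factor_class_surj v; have [h Nh <-] := factor_class_surj w.
  have Nh' := nsubV Nh; have Ngh := nsubM Ng Nh'; have N'h := nsubV (fN Nh).
  rewrite -(factor_classV Nh) -factor_classM // !factor_map_class //.
  rewrite gmulfM gmulfV factor_classM //; last exact: fN.
  congr (_ + _)%R; apply: factor_val_inj.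
  by rewrite sval_opp !sval_class ?coset_piV //; exact: fN.
have [g Ng <-] := factor_class_surj v; rewrite -(coset_pi_repr c) -factor_classJ //.
rewrite !factor_map_class //; last exact: nsub_conj.
rewrite quotient_map_coset -factor_classJ; last exact: fN.
by rewrite !conjgE !gmulfM gmulfV.
Qed.

Lemma quotient_map_inj : (forall g, N' (f g) -> N g) -> injective quotient_map.
Proof.
move=> fN' c d; rewrite -(coset_pi_repr c) -(coset_pi_repr d) !quotient_map_coset.
by move=> /coset_piP; rewrite -gmulfV -gmulfM => /fN' H; apply/coset_piP.
Qed.

Lemma factor_map_eq0 v : (forall g, N g -> M' (f g) -> M g) ->
  factor_map v = 0%R -> v = 0%R.
Proof.
move=> fM'; have [g Ng <-] := factor_class_surj v; rewrite factor_map_class //.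
move/factor_class_eq0 => H; apply/factor_class_eq0 => //.
by apply: fM' => //; apply: H; exact: fN.
Qed.

End Induced.

End FactorMaps.

(** * Commutators in rigid groups and uniqueness of the principal series *)

Section PrincipalSeries.
Local Open Scope group_scope.

(** The commutator $[a,h]$, in the form that shows it as $h - 1$ acting on the class of $a$ in a
    factor. *)
Definition com (G : groupType) (a h : G) : G := a^-1 * a ^ h.

Lemma comV (G : groupType) (a h : G) : (com a h)^-1 = com h a.
Proof. by rewrite /com !conjgE !invgM !invgK !mulgA. Qed.

Lemma gmulf_com (G H : groupType) (f : {hom G -> H}) a h :
  f (com a h) = com (f a) (f h).
Proof. by rewrite /com !conjgE !gmulfM !gmulfV. Qed.

(* Principal series indexed by nat, so that consecutive terms need no casts;
   the terms beyond n are irrelevant. *)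
Record pser (G : groupType) (n : nat) (S : nat -> normalSubgroup G) : Prop := Pser {
  pser0 : forall x, S 0%N x;
  pser_last : forall x, S n x -> x = 1;
  pserS : forall i x, (i < n)%N -> S i.+1 x -> S i x;
  pser_proper : forall i, (i < n)%N -> exists2 x, S i x & ~ S i.+1 x;
  pser_ab : forall i, (i < n)%N -> abelian_factor (S i) (S i.+1);
  pser_tf : forall i, (i < n)%N -> torsion_free_factor (S i) (S i.+1)
}.

Lemma nsub_inj (G : groupType) (N M : normalSubgroup G) :
  (forall x, N x <-> M x) -> N = M.
Proof.
case: N M => [N N1 N2] [M M1 M2] /= NM.
have E : N = M by apply/funext => x; apply/propext; exact: NM.
case: _ / E M1 M2 {NM} => M1 M2; congr NormalSubgroup; exact: Prop_irrelevance.
Qed.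

Lemma principal_series_pser (G : groupType) (n : nat) (s : 'I_n.+1 -> normalSubgroup G) :
  principal_series s -> pser n (fun i => s (inord i)).
Proof.
move=> [s0 sn sS].
have s0E : inord 0 = ord0 :> 'I_n.+1 by apply: val_inj; rewrite /= inordK.
have snE : inord n = ord_max :> 'I_n.+1 by apply: val_inj; rewrite /= inordK.
have iE i (lt : (i < n)%N) : inord i = widen_ord (leqnSn n) (Ordinal lt).
  by apply: val_inj; rewrite /= inordK // ltnW.
have iSE i (lt : (i < n)%N) : inord i.+1 = lift ord0 (Ordinal lt).
  by apply: val_inj; rewrite /= inordK.
split=> [x|x|i x lt|i lt|i lt|i lt].
- by rewrite s0E s0.
- by rewrite snE sn.
- by rewrite (iE i lt) iSE; have [[sub _] _ _] := sS (Ordinal lt); exact: sub.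
- rewrite (iE i lt) iSE; have [[_ nsub] _ _] := sS (Ordinal lt).
  apply: contrapT => H; apply: nsub => x sx; apply: contrapT => nsx.
  by apply: H; exists x.
- by rewrite (iE i lt) iSE; have [] := sS (Ordinal lt).
- by rewrite (iE i lt) iSE; have [] := sS (Ordinal lt).
Qed.

Lemma pser_principal_series (G : groupType) (n : nat) (S : nat -> normalSubgroup G) :
  pser n S -> principal_series (fun i : 'I_n.+1 => S i).
Proof.
move=> P; split.
- by apply/seteqP; split=> // x _; exact: pser0 P x.
- apply/seteqP; split=> x; first exact: pser_last.
  by move=> ->; exact: nsub1.
- move=> [i lt]; rewrite /= /bump /=; split.
  + split; first by move=> x; exact: pserS P _ _ lt.
    by have [x Sx nSx] := pser_proper P lt; move=> /(_ x Sx).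
  + exact: pser_ab P _ lt.
  + exact: pser_tf P _ lt.
Qed.

Section OneSeries.
Variables (G : groupType) (n : nat) (S : nat -> normalSubgroup G).
Hypothesis P : pser n S.

Lemma pser_com_sub i x g : S i x -> S i (com x g).
Proof. by move=> Sx; apply: nsubM; [exact: nsubV | exact: nsub_conj]. Qed.

Lemma pser_com_in i x g : (i < n)%N -> S i x -> S i g -> S i.+1 (com x g).
Proof.
move=> lt Sx Sg; apply/coset_pi_eq1.
rewrite coset_piM coset_piV coset_piJ conjgE.
have -> : coset_pi (S i.+1) x * coset_pi (S i.+1) g =
  coset_pi (S i.+1) g * coset_pi (S i.+1) x.
  by apply: (pser_ab P lt); apply/mem_set; [exists x | exists g].
by rewrite mulKg mulVg.
Qed.

(** The hypothesis says that $g - 1$ annihilates the nonzero class of $x$, so $g - 1$ vanishes in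
    the group ring of the quotient by [S i]. *)
Lemma pser_com_out i x g : (i < n)%N -> S i x -> ~ S i.+1 x ->
  S i.+1 (com x g) -> S i g.
Proof.
move=> lt Sx nSx Sc; have ab := pser_ab P lt.
have tf := (torsion_free_factorP ab).1 (pser_tf P lt).
pose v := factor_class ab x.
have [|v0|] := tf v [:: (coset_pi (S i) g, 1%R); (1, (-1)%R)].
- rewrite /scal !big_cons big_nil /= mulr1z mulrNz mulr1z addr0.
  rewrite (act1 (factor_conj_action ab)) -factor_classJ //.
  have Sxg : S i (x ^ g) by exact: nsub_conj.
  rewrite -factor_classV // addrC -factor_classM //; last exact: nsubV.
  by apply/factor_class_eq0 => //; apply: nsubM => //; exact: nsubV.
- by case: nSx; exact/(factor_class_eq0 ab Sx).
- move=> /(_ (coset_pi (S i) g)); rewrite /coef !big_cons big_nil /= eqxx.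
  by case: eqP => [/esym/coset_pi_eq1|].
Qed.

(** The quotient by [S i.+1] is an extension of the quotient by [S i] with abelian kernel. *)
Lemma pser_folner i : (i <= n)%N -> folner (quotientGroup (S i)).
Proof.
elim: i => [_|i IH lt].
  apply: folner_trivial => c; rewrite -(coset_pi_repr c); apply/coset_pi_eq1.
  exact: pser0 P _.
pose p (c : quotientGroup (S i.+1)) := coset_pi (S i) (repr c).
pose t (c : quotientGroup (S i)) := coset_pi (S i.+1) (repr c).
have pE g : p (coset_pi (S i.+1) g) = coset_pi (S i) g.
  apply/coset_piP; apply: (pserS P lt); apply/coset_piP; exact: coset_pi_repr.
apply: (@folner_extension _ _ p t) (IH (ltnW lt)).
- move=> c d; rewrite -(coset_pi_repr c) -(coset_pi_repr d) -coset_piM !pE.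
  exact: coset_piM.
- by move=> c; rewrite /t pE coset_pi_repr.
- move=> c d /coset_pi_eq1 Sc /coset_pi_eq1 Sd.
  rewrite -(coset_pi_repr c) -(coset_pi_repr d).
  by apply: (pser_ab P lt); apply/mem_set; [exists (repr c) | exists (repr d)].
Qed.

(* [a_(i+k-1), ... [a_(i+1), [a_i, h]]] *)
Fixpoint wit (H : groupType) (a : nat -> H) (i k : nat) (h : H) : H :=
  if k is k'.+1 then com (a (i + k')%N) (wit a i k' h) else h.

Definition witnesses (a : nat -> G) : Prop :=
  forall i, (i < n)%N -> S i (a i) /\ ~ S i.+1 (a i).

(** Commutation with $a_k$ maps [S k] into [S k.+1] and the complement of [S k] into the complement
    of [S k.+1]; iterated up to the trivial term, it turns membership into an equation. *)
Lemma pser_witP a i h : witnesses a -> (i <= n)%N ->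
  S i h <-> wit a i (n - i) h = 1.
Proof.
move=> aP le; split=> [Sh|].
  have H k : (i + k <= n)%N -> S (i + k)%N (wit a i k h).
    elim: k => [|k IH]; first by rewrite addn0.
    rewrite addnS => lt; apply: pser_com_in => //; last exact: IH (ltnW lt).
    exact: (aP _ lt).1.
  by apply: (pser_last P); have := H (n - i)%N; rewrite subnKC //; exact.
apply: contraPP => nSh w1.
have H k : (i + k <= n)%N -> ~ S (i + k)%N (wit a i k h).
  elim: k => [|k IH]; first by rewrite addn0.
  rewrite addnS => lt Sw; apply: (IH (ltnW lt)).
  have [Sa nSa] := aP _ lt; exact: pser_com_out Sw.
by have := H (n - i)%N; rewrite subnKC // w1 => /(_ (leqnn n)); apply; exact: nsub1.
Qed.

(** As a commutator of two conjugates of [a], the new element also lies in term $i+1$ of any other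
    principal series whose term $i$ contains [a]. *)
Lemma pser_com_step i a y : (i.+1 < n)%N -> S i a -> ~ S i.+1 a ->
  S i.+1 y -> ~ S i.+2 y ->
  S i.+1 (com a (a ^ y)) /\ ~ S i.+2 (com a (a ^ y)).
Proof.
move=> lt Sa nSa Sy nSy; have lti := ltnW lt.
split; first by apply: pser_com_in => //; exact: nsub_conj.
have Sz : S i.+1 (com a y) by rewrite -comV; apply: nsubV; exact: pser_com_sub.
have nSz : ~ S i.+2 (com a y).
  move=> /nsubV; rewrite comV => /(pser_com_out lt Sy nSy); exact: nSa.
(* This holds because $a^y = a[a,y]$ and conjugation by $a$ fixes $a$. *)
have -> : com a (a ^ y) = com a (com a y).
  rewrite -[a ^ y](mulVKg a) -/(com a y); rewrite /com conjgM.
  by rewrite [a ^ a]conjgE mulKg.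
move=> /nsubV; rewrite comV => /(pser_com_out lt Sz nSz); exact: nSa.
Qed.

End OneSeries.

Section TwoSeries.
Variables (G : groupType) (n : nat) (S S' : nat -> normalSubgroup G).
Hypotheses (P : pser n S) (P' : pser n S').

Lemma pser_common_witnesses : exists a, witnesses n S a /\ witnesses n S' a.
Proof.
pose good i a := [/\ S i a, ~ S i.+1 a, S' i a & ~ S' i.+1 a].
(* One of [c], [c'] and [c * c'] lies outside the next term of both series. *)
have join i c c' : S i c -> ~ S i.+1 c -> S' i c -> S' i c' -> ~ S' i.+1 c' -> S i c' ->
    exists a, good i a.
  move=> Sc nSc S'c S'c' nS'c' Sc'.
  have [S'c1|] := pselect (S' i.+1 c); last by exists c.
  have [Sc1'|] := pselect (S i.+1 c'); last by exists c'.
  exists (c * c'); split; [exact: nsubM | | exact: nsubM |].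
  - by move=> H; apply: nSc; rewrite -[c](mulgK c'); exact: nsubF.
  - move=> H; apply: nS'c'; rewrite -[c'](mulKg c); apply: nsubM => //.
    exact: nsubV.
have ex i : (i < n)%N -> exists a, good i a.
  elim: i => [|i IH] lt.
    have [x Sx nSx] := pser_proper P lt; have [y Sy nSy] := pser_proper P' lt.
    by apply: (@join 0%N x y) => //; [exact: pser0 P' _ | exact: pser0 P _].
  have [a [Sa nSa S'a nS'a]] := IH (ltnW lt).
  have [x Sx nSx] := pser_proper P lt; have [y Sy nSy] := pser_proper P' lt.
  have [Sc nSc] := pser_com_step P lt Sa nSa Sx nSx.
  have [Sc' nSc'] := pser_com_step P' lt S'a nS'a Sy nSy.
  apply: (join _ _ _ Sc nSc _ Sc' nSc').
  - by apply: (pser_com_in P' (ltnW lt)) => //; exact: nsub_conj.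
  - by apply: (pser_com_in P (ltnW lt)) => //; exact: nsub_conj.
have : forall i, exists a, (i < n)%N -> good i a.
  move=> i; have [/ex[a ga]|] := boolP (i < n)%N; first by exists a.
  by exists 1.
by move=> /choice[a aP]; exists a; split=> i /aP[].
Qed.

(** With common witnesses, membership in either term is the same equation. *)
Lemma pser_uniq i : (i <= n)%N -> S i = S' i.
Proof.
move=> le; have [a [aS aS']] := pser_common_witnesses.
apply: nsub_inj => x.
by rewrite (pser_witP P x aS le) (pser_witP P' x aS' le).
Qed.

End TwoSeries.

Lemma pser_witnesses (G : groupType) n (S : nat -> normalSubgroup G) :
  pser n S -> exists a, witnesses n S a.
Proof. by move=> P; have [a []] := pser_common_witnesses P P; exists a. Qed.

Lemma wit_hom (G H : groupType) (f : {hom G -> H}) (a : nat -> G) i k h :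
  f (wit a i k h) = wit (fun j => f (a j)) i k (f h).
Proof. by elim: k => //= k <-; exact: gmulf_com. Qed.

Lemma wit_ext (G : groupType) (a b : nat -> G) i k h :
  a =1 b -> wit a i k h = wit b i k h.
Proof. by move=> ab; elim: k => //= k ->; rewrite ab. Qed.

End PrincipalSeries.

(** * The principal series and ranks of a discriminated group *)

Section Discriminated.
Local Open Scope group_scope.

Definition pranks (G : groupType) n (S : nat -> normalSubgroup G) (r : nat -> nat) : Prop :=
  forall i, (i < n)%N -> is_factor_rank (S i) (S i.+1) (r i).

Lemma pser_rankP (G : groupType) n (S : nat -> normalSubgroup G) (P : pser n S) i
    (lt : (i < n)%N) r :
  is_factor_rank (S i) (S i.+1) r <-> has_rank (pser_ab P lt) r.
Proof.
by apply: is_factor_rankP; [exact: pser_folner (ltnW lt) | exact: pser_tf P _ lt].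
Qed.

(** The generator bound with [A0] trivial and [b] empty makes every rank finite. *)
Lemma fg_pranks (G : groupType) n (S : nat -> normalSubgroup G) :
  finitely_generated G -> pser n S -> exists r, pranks n S r.
Proof.
move=> [X genX] P.
have ex i : exists r, (i < n)%N -> is_factor_rank (S i) (S i.+1) r.
  have [lt|_] := boolP (i < n)%N; last by exists 0%N.
  have [|r Hr _] := bounded_has_rank (ab := pser_ab P lt) (pser_folner P (ltnW lt))
    (pser_tf P lt) (k := size X); last by exists r => _; exact: (pser_rankP P lt r).2 Hr.
  move=> s fs; rewrite -[X in (_ <= X)%N]add0n.
  apply: (@factor_generators _ _ _ _ (fun x => x = 1) X [::] s
    (pser_folner P (ltnW lt)) (pser_tf P lt) _ _ _ fs).
  - by split=> // x y -> ->; rewrite divg1.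
  - by move=> C Cs _ CX; exact: genX.
  - move=> a -> _; apply: span_cl; first exact: factor_conj_action.
    have -> : factor_class (pser_ab P lt) 1 = 0%R.
      exact: (factor_class_eq0 _ (nsub1 _)).2 (nsub1 _).
    by move=> C [[C0 _] _].
by have [r Hr] := choice ex; exists r.
Qed.

Variables (A : groupType) (n : nat) (S : nat -> normalSubgroup A) (P : pser n S).

Section OneGroup.
Variables (H : groupType) (j : {hom A -> H}).
Hypothesis disc : discriminated j.

Definition retraction (f : {hom H -> A}) : Prop := forall a, f (j a) = a.

Definition pull_set (i : nat) (h : H) : Prop :=
  forall f : {hom H -> A}, retraction f -> S i (f h).

Lemma pull_subgroup i : is_subgroup (pull_set i).
Proof.
split=> [f _|x y Tx Ty f rf]; first by rewrite gmulf1; exact: nsub1.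
by rewrite gmulfF; apply: nsubF; [exact: Tx | exact: Ty].
Qed.

Lemma pull_conj i x g : pull_set i x -> pull_set i (x ^ g).
Proof.
move=> Tx f rf; rewrite conjgE !gmulfM gmulfV -conjgE.
by apply: nsub_conj; exact: Tx.
Qed.

Definition pull i : normalSubgroup H := NormalSubgroup (@pull_subgroup i) (@pull_conj i).

Lemma pull_retraction i f h : retraction f -> pull i h -> S i (f h).
Proof. by move=> rf Th; exact: Th. Qed.

Lemma pull_base i a : pull i (j a) <-> S i a.
Proof.
split=> [Ta|Sa f rf]; last by rewrite rf.
by have [f [rf _]] := disc fset0; rewrite -(rf a); exact: Ta.
Qed.

(** By [pser_witP] each nonmember has a nontrivial iterated commutator with the constants [j (a i)];
    a retraction injective on [1] and these finitely many commutators keeps them nontrivial. *)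
Lemma pull_separate (l : seq (nat * H)) :
  (forall p, p \in l -> (p.1 <= n)%N /\ ~ pull p.1 p.2) ->
  exists2 f : {hom H -> A}, retraction f & forall p, p \in l -> ~ S p.1 (f p.2).
Proof.
move=> Hl; have [a aP] := pser_witnesses P.
pose w (p : nat * H) := wit (fun i => j (a i)) p.1 (n - p.1) p.2.
have [f [rf finj]] := disc [fset x in 1 :: map w l]%fset.
have wf (g : {hom H -> A}) p : retraction g -> g (w p) = wit a p.1 (n - p.1) (g p.2).
  by move=> rg; rewrite wit_hom; apply: wit_ext => i; exact: rg.
exists f => // p pl; have [le nT] := Hl p pl.
move=> /(pser_witP P _ aP le); rewrite -wf // => fw.
have w1 : w p = 1.
  apply: finj; rewrite ?gmulf1 // !inE ?eqxx //.
  by rewrite map_f ?orbT.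
by apply: nT => g rg; apply/(pser_witP P _ aP le); rewrite -wf // w1 gmulf1.
Qed.

Lemma pull_ab i : (i < n)%N -> abelian_factor (pull i) (pull i.+1).
Proof.
move=> lt _ _ /set_mem[x Tx <-] /set_mem[y Ty <-].
rewrite -!coset_piM; apply/coset_piP => f rf.
rewrite gmulfM gmulfV !gmulfM; apply/coset_piP; rewrite !coset_piM.
by apply: (pser_ab P lt); apply/mem_set; [exists (f x) | exists (f y)] => //;
  exact: pull_retraction.
Qed.

Lemma retraction_exists i (T : seq (quotientGroup (pull i))) (l : seq (nat * H)) :
  (i <= n)%N -> (forall p, p \in l -> (p.1 <= n)%N /\ ~ pull p.1 p.2) ->
  exists f : {hom H -> A}, [/\ retraction f, forall p, p \in l -> ~ S p.1 (f p.2) &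
    {in T &, injective (quotient_map (S i) f : quotientGroup (pull i) -> _)}].
Proof.
move=> le Hl.
(* Injectivity on [T] is a further separation condition: the quotients of distinct cosets must stay
   outside [S i]. *)
pose l' := [seq (i, (repr c)^-1 * repr d) | c <- T, d <- T].
have [|f rf Hf] := @pull_separate (l ++ [seq p <- l' | `[< ~ pull p.1 p.2 >]]).
  move=> p; rewrite mem_cat mem_filter => /orP[/Hl //|/andP[/asboolP nT]].
  by move=> /allpairsP[[c d] [_ _ pE]]; split=> //; rewrite pE.
exists f; split=> // [p pl|c d cT dT].
  by apply: Hf; rewrite mem_cat pl.
rewrite -(coset_pi_repr c) -(coset_pi_repr d).
have sub h : pull i h -> S i (f h) := pull_retraction rf.
rewrite !(quotient_map_coset sub) => /coset_piP; rewrite -gmulfV -gmulfM => Sf; apply/coset_piP.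
apply: contrapT => nT; apply: (Hf (i, (repr c)^-1 * repr d)) => //.
rewrite mem_cat mem_filter; apply/orP; right; apply/andP; split; first exact/asboolP.
by apply/allpairsP; exists (c, d).
Qed.

Lemma pull_pser : pser n pull.
Proof.
split.
- by move=> x f _; exact: pser0 P _.
- move=> x Tx; have [f [rf finj]] := disc [fset x; 1]%fset.
  apply: finj; rewrite ?inE ?eqxx ?orbT // gmulf1.
  by apply: (pser_last P); exact: Tx.
- by move=> i x lt Tx f rf; apply: (pserS P lt); exact: Tx.
- move=> i lt; have [x Sx nSx] := pser_proper P lt.
  by exists (j x); [exact/pull_base | move=> /pull_base].
- exact: pull_ab.
- move=> i lt; have abH := pull_ab lt; apply/(torsion_free_factorP abH).
  apply: (torsion_free_reflect (act' := @factor_conj _ _ _ (pser_ab P lt))).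
    by apply/torsion_free_factorP; exact: pser_tf P _ lt.
  move=> x T; have [g Tg <-] := factor_class_surj x => xn.
  have [|f [rf Hf finj]] := @retraction_exists i T [:: (i.+1, g)] (ltnW lt).
    by move=> p; rewrite inE => /eqP ->; split=> // /(factor_class_eq0 abH Tg).
  exists (factor_map (pser_ab P lt) f), (quotient_map (S i) f); split=> //.
    by apply: factor_map_semilinear => h; [|move=> _]; exact: pull_retraction.
  have sub h : pull i h -> S i (f h) := pull_retraction rf.
  rewrite factor_map_class //; last by move=> h _; exact: pull_retraction.
  move=> /factor_class_eq0 Sg; apply: (Hf (i.+1, g)); first exact: mem_head.
  by apply: Sg; exact: pull_retraction.
Qed.

(** Lower bound: retractions invert on the left the map induced by [j], so a basis over [A] stays
    independent. Upper bound: the generator bound with [A0] the image of [A] and [b] the image of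
    that basis. *)
Lemma pull_pranks (X : seq H) (r : nat -> nat) :
  (forall C : set H, is_subgroup C -> (forall a, C (j a)) ->
     (forall x, x \in X -> C x) -> C = setT) ->
  pranks n S r ->
  exists2 r', pranks n pull r' & forall i, (i < n)%N -> (r i <= r' i <= r i + size X)%N.
Proof.
move=> gen Sr.
have ex i : exists r', (i < n)%N -> is_factor_rank (pull i) (pull i.+1) r' /\
    (r i <= r' <= r i + size X)%N.
  have [lt|_] := boolP (i < n)%N; last by exists 0%N.
  have abA := pser_ab P lt; have abH := pser_ab pull_pser lt.
  have [s [sr fs sV]] := (is_factor_rankP abA (pser_folner P (ltnW lt)) (pser_tf P lt) _).1 (Sr i lt).
  have folH := pser_folner pull_pser (ltnW lt).
  have tfH := pser_tf pull_pser lt.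
  have jN g : S i g -> pull i (j g) by move=> Sg; exact/pull_base.
  have jM g : S i g -> S i.+1 g -> pull i.+1 (j g) by move=> _ Sg; exact/pull_base.
  pose jmap := factor_map (ab := abA) abH j.
  have retK f : retraction f -> cancel jmap (factor_map (ab := abH) abA f).
    move=> rf v; have [g Sg <-] := factor_class_surj v.
    rewrite /jmap !factor_map_class ?rf //; try exact: jN.
    - by move=> h; exact: pull_retraction.
    - by move=> h _; exact: pull_retraction.
  have us : uniq (map jmap s).
    have [f [rf _]] := disc fset0.
    by rewrite (map_inj_uniq (can_inj (retK f rf))) fs.1.
  have fjs : free_seq (@factor_conj _ _ _ abH) (map jmap s).
    apply: (free_reflect (act' := @factor_conj _ _ _ abA) us) => T.
    have [//|f [rf _ finj]] := @retraction_exists i T [::] (ltnW lt).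
    exists (factor_map (ab := abH) abA f), (quotient_map (S i) f); split=> //.
      by apply: factor_map_semilinear => h; [|move=> _]; exact: pull_retraction.
    by rewrite -map_comp (eq_map (retK f rf)) map_id.
  have [|r' Hr' le] := bounded_has_rank (ab := abH) folH tfH (k := (r i + size X)%N).
    move=> t ft; rewrite -sr -(size_map jmap).
    apply: (@factor_generators _ _ _ abH (fun x => exists a, x = j a) X
      (map jmap s) t folH tfH _ _ _ ft).
    - split; first by exists 1; rewrite gmulf1.
      by move=> _ _ [a ->] [b ->]; exists (a / b); rewrite gmulfF.
    - by move=> C Cs CA CX; apply: gen => // a; apply: CA; exists a.
    - move=> _ [a ->] /pull_base Sa; rewrite -(factor_map_class abA abH) //.
      apply: (semilinear_cl (factor_map_semilinear _ _ jN jM)) => //.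
      by apply: quotient_map_inj => // g /pull_base.
  exists r' => _; split; first exact/(is_factor_rankP abH).
  rewrite le andbT -sr -(size_map jmap).
  exact: (has_rank_le (ab := abH) folH tfH Hr').
have [r' Hr'] := choice ex; exists r' => i /(Hr' i) [] //.
Qed.

End OneGroup.

End Discriminated.

(** * Ranks under a proper epimorphism *)

Section ProperEpimorphism.
Local Open Scope group_scope.
Variables (G G' : groupType) (n : nat).
Variables (S : nat -> normalSubgroup G) (S' : nat -> normalSubgroup G').
Hypotheses (P : pser n S) (P' : pser n S').
Variable p : {hom G -> G'}.
Hypothesis p_surj : forall y, exists x, p x = y.
Hypothesis pS : forall i g, (i <= n)%N -> S i g -> S' i (p g).

Section OneFactor.
Variable i : nat.
Hypotheses (lt : (i < n)%N) (pS' : forall g, S' i (p g) -> S i g).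

Let ab := pser_ab P lt.
Let ab' := pser_ab P' lt.
Let folQ := pser_folner P (ltnW lt).
Let folQ' := pser_folner P' (ltnW lt).
Let tf := pser_tf P lt.
Let tf' := pser_tf P' lt.
Let phi : factor_module ab -> factor_module ab' := factor_map ab' p.
Let psi : quotientGroup (S i) -> quotientGroup (S' i) := quotient_map (S' i) p.

Let pN g : S i g -> S' i (p g). Proof. exact: pS (ltnW lt). Qed.
Let pM g : S i g -> S i.+1 g -> S' i.+1 (p g). Proof. by move=> _; exact: pS. Qed.

Let slin : semilinear (@factor_conj _ _ _ ab) (@factor_conj _ _ _ ab') phi psi.
Proof. exact: factor_map_semilinear. Qed.

Let psi_inj : injective psi. Proof. exact: quotient_map_inj. Qed.

Let phi_surj : exists g, cancel g phi.
Proof.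
suff /choice[g gK] : forall v, exists w, phi w = v by exists g.
move=> v; have [h S'h <-] := factor_class_surj v.
have [g pg] := p_surj h.
exists (factor_class ab g); rewrite -pg in S'h *.
by rewrite /phi factor_map_class //; exact: pS'.
Qed.

(** Lifts of a basis are independent because [psi] is injective. *)
Lemma epi_rank_ge r r' : is_factor_rank (S i) (S i.+1) r ->
  is_factor_rank (S' i) (S' i.+1) r' -> (r' <= r)%N.
Proof.
move=> /(is_factor_rankP ab folQ tf) Hr /(is_factor_rankP ab' folQ' tf')[s [<- fs _]].
have [g gK] := phi_surj; rewrite -(size_map g).
apply: (has_rank_le folQ tf Hr).
apply: (free_reflect (act' := @factor_conj _ _ _ ab')).
  by rewrite (map_inj_uniq (can_inj gK)) fs.1.
move=> T; exists phi, psi; split=> //; first by move=> ? ? _ _; exact: psi_inj.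
by rewrite -map_comp (eq_map gK) map_id.
Qed.

(** The added hypothesis makes [phi] injective; as [psi] is surjective, independence passes to the
    image. *)
Lemma epi_rank_le r r' : (forall g, S' i.+1 (p g) -> S i.+1 g) ->
  is_factor_rank (S i) (S i.+1) r ->
  is_factor_rank (S' i) (S' i.+1) r' -> (r <= r')%N.
Proof.
move=> pS1 /(is_factor_rankP ab folQ tf)[s [<- fs _]] /(is_factor_rankP ab' folQ' tf') Hr'.
have psi_surj : exists q, cancel q psi.
  suff /choice[q qK] : forall c, exists d, psi d = c by exists q.
  move=> c; have [g pg] := p_surj (repr c).
  exists (coset_pi (S i) g).
  by rewrite /psi quotient_map_coset // pg coset_pi_repr.
have [q qK] := psi_surj; rewrite -(size_map phi).
apply: (has_rank_le folQ' tf' Hr'); apply: (free_image slin _ qK fs).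
apply: (semilinear_inj slin) => v; apply: factor_map_eq0 => //.
by move=> g _; exact: pS1.
Qed.

(** Applying [phi] to a relation kills the coefficients of the lifted basis; torsion freeness then
    kills that of the kernel element [x0]. *)
Lemma epi_rank_gt r r' h : S' i.+1 (p h) -> ~ S i.+1 h ->
  is_factor_rank (S i) (S i.+1) r ->
  is_factor_rank (S' i) (S' i.+1) r' -> (r' < r)%N.
Proof.
move=> S'h nSh /(is_factor_rankP ab folQ tf) Hr /(is_factor_rankP ab' folQ' tf')[s [<- fs _]].
have Sh : S i h by apply: pS'; exact: pserS P' _ _ lt S'h.
pose x0 := factor_class ab h.
have x0n : x0 <> 0%R by move=> /(factor_class_eq0 ab Sh).
have phi0 : phi x0 = 0%R.
  by rewrite /phi factor_map_class //; apply/(factor_class_eq0 ab' (pN Sh)).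
have [g gK] := phi_surj.
have fgs : free_seq (@factor_conj _ _ _ ab') (map phi (map g s)).
  by rewrite -map_comp (eq_map gK) map_id.
have ugs : uniq (map g s) by rewrite (map_inj_uniq (can_inj gK)) fs.1.
have x0g : x0 \notin map g s.
  apply/negP => /(map_f phi) x0s.
  by apply: (free_neq0 (factor_conj_action ab') fgs x0s); exact: phi0.
suff free_x0 : free_seq (@factor_conj _ _ _ ab) (x0 :: map g s).
  by have := has_rank_le folQ tf Hr free_x0; rewrite /= size_map.
split; first by rewrite /= x0g.
move=> u; rewrite big_cons => u0.
have us x : x \in map g s -> null_scalar (u x).
  apply: (free_reflect_relation slin _ fgs ugs); first by move=> ? ? _ _; exact: psi_inj.
  have := congr1 phi u0; rewrite (semilinearD slin) (semilinear_scal slin) phi0.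
  by rewrite (scal0 (factor_conj_action ab')) add0r (semilinear0 slin).
move=> x; rewrite inE => /predU1P[->|]; last exact: us.
have : scal (@factor_conj _ _ _ ab) x0 (u x0) = 0%R.
  rewrite -[RHS]u0 big1_seq ?addr0 // => y /= ys.
  by apply: scal_null; exact: us.
by move=> /(torsion_free_factorP ab).1 => /(_ tf) [].
Qed.

End OneFactor.

Lemma epi_pranks r r' : pranks n S r -> pranks n S' r' ->
  (exists2 h, p h = 1 & h <> 1) ->
  exists2 i, (i < n)%N & (r' i < r i)%N /\ forall k, (k < i)%N -> r k = r' k.
Proof.
move=> Sr Sr' [h0 ph0 h0n].
(* The index [k] is bad when the preimage of [S' k] exceeds [S k]. A kernel element makes [n] bad
   and [0] is never bad, so the least bad index is some [i.+1], and the rank drops at factor [i]. *)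
pose bad k := `[< exists2 h, S' k (p h) & ~ S k h >].
have exbad : exists k, bad k.
  exists n; apply/asboolP; exists h0; first by rewrite ph0; exact: nsub1.
  by move=> /(pser_last P).
case: (ex_minnP exbad) => k /asboolP[h S'h nSh] mink.
have kn : (k <= n)%N.
  apply: mink; apply/asboolP; exists h0; first by rewrite ph0; exact: nsub1.
  by move=> /(pser_last P).
have good l : (l < k)%N -> forall g, S' l (p g) -> S l g.
  move=> lk g S'g; apply: contrapT => nSg; suff : (k <= l)%N by rewrite leqNgt lk.
  by apply: mink; apply/asboolP; exists g.
case: k S'h nSh kn good mink => [|i] S'h nSh lt good mink.
  by case: nSh; exact: pser0 P _.
exists i => //; split.
  by apply: (epi_rank_gt lt _ S'h nSh (Sr i lt) (Sr' i lt)); exact: good.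
move=> k ki; have kn : (k < n)%N by exact: ltn_trans lt.
have lek : (k < i.+1)%N by exact: ltnW.
apply/eqP; rewrite eqn_leq; apply/andP; split.
  by apply: (epi_rank_le kn _ (Sr k kn) (Sr' k kn)); exact: good.
by apply: (epi_rank_ge kn _ (Sr k kn) (Sr' k kn)); exact: good.
Qed.

End ProperEpimorphism.

(** * Ranks of quotients and chains of prime ideals *)

Section QuotientRanks.
Local Open Scope group_scope.

Section Projection.
Variables (G : groupType) (N M : normalSubgroup G).

(** The inclusion is an argument so that a morphism structure can be attached to the map. *)
Definition quotient_proj of (forall x, N x -> M x) : quotientGroup N -> quotientGroup M :=
  fun c => coset_pi M (repr c).

Variable NM : forall x, N x -> M x.

Lemma quotient_proj_coset g : quotient_proj NM (coset_pi N g) = coset_pi M g.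
Proof. by apply/coset_piP; apply: NM; apply/coset_piP; exact: coset_pi_repr. Qed.

Lemma quotient_projM : {morph quotient_proj NM : x y / x * y}.
Proof.
move=> c d; rewrite -(coset_pi_repr c) -(coset_pi_repr d) -coset_piM.
by rewrite !quotient_proj_coset coset_piM.
Qed.

HB.instance Definition _ :=
  monoid.isUMagmaMorphism.Build _ _ (quotient_proj NM) (morphM_monoid quotient_projM).

End Projection.

(** The tuple picked by [xget] is forced, since both the series and the rank of each factor are
    unique. *)
Lemma rigid_rankE (G : groupType) n (S : nat -> normalSubgroup G) r :
  pser n S -> pranks n S r -> forall i : 'I_n, tnth (rigid_rank n G) i = r i.
Proof.
move=> P Sr i.
have [s sP rs] : is_rigid_rank G (rigid_rank n G).
  apply: xgetPex; exists [tuple r i | i < n].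
  exists (fun i : 'I_n.+1 => S i); first exact: pser_principal_series.
  by move=> k; rewrite tnth_mktuple; exact: (Sr k (ltn_ord k)).
have P' := principal_series_pser sP.
have := rs i; have -> : s (widen_ord (leqnSn n) i) = S i.
  rewrite (pser_uniq P P' (ltnW (ltn_ord i))); congr s.
  by apply: val_inj; rewrite /= inordK //; exact: ltnW (ltn_ord i).
have -> : s (lift ord0 i) = S i.+1.
  rewrite (pser_uniq P P' (ltn_ord i)); congr s.
  by apply: val_inj; rewrite /= inordK //; exact: (ltn_ord i).
move=> /(pser_rankP P (ltn_ord i)) H.
move/(pser_rankP P (ltn_ord i)): (Sr i (ltn_ord i)).
exact: has_rank_uniq (pser_folner P (ltnW (ltn_ord i))) (pser_tf P (ltn_ord i)) _ _ H.
Qed.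

Variables (A : groupType) (n : nat) (S : nat -> normalSubgroup A) (r : nat -> nat).
Hypotheses (P : pser n S) (Sr : pranks n S r).
Variables (G : groupType) (j : {hom A -> G}) (X : seq G).
Hypothesis gen : forall C : set G, is_subgroup C -> (forall a, C (j a)) ->
  (forall x, x \in X -> C x) -> C = setT.

Definition const_quotient (N : normalSubgroup G) : {hom A -> quotientGroup N} :=
  coset_pi N \o j.

Lemma quotient_generators (N : normalSubgroup G) (C : set (quotientGroup N)) :
  is_subgroup C -> (forall a, C (const_quotient N a)) ->
  (forall x, x \in map (coset_pi N) X -> C x) -> C = setT.
Proof.
move=> [C1 CF] CA CX.
have E : [set g | C (coset_pi N g)]%classic = setT.
  apply: gen => [|a|x xX]; last by apply: CX; exact: map_f.
    split=> [|x y Cx Cy] /=; first exact: C1.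
    by rewrite coset_piM coset_piV; exact: CF.
  exact: CA.
apply/seteqP; split=> // c _; rewrite -(coset_pi_repr c).
by have : [set: G]%classic (repr c) by []; rewrite -E.
Qed.

Lemma quotient_pranks (N : normalSubgroup G) : discriminated (const_quotient N) ->
  exists2 r', pranks n (pull S (const_quotient N)) r' &
    forall i, (i < n)%N -> (r i <= r' i <= r i + size X)%N.
Proof.
move=> disc; rewrite -(size_map (coset_pi N)).
by apply: (pull_pranks P disc) => // C; exact: quotient_generators.
Qed.

Lemma quotient_lex (N M : normalSubgroup G) r1 r2 :
  discriminated (const_quotient N) -> discriminated (const_quotient M) ->
  (forall x, N x -> M x) -> (exists2 x, M x & ~ N x) ->
  pranks n (pull S (const_quotient N)) r1 -> pranks n (pull S (const_quotient M)) r2 ->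
  exists2 i, (i < n)%N & (r2 i < r1 i)%N /\ forall k, (k < i)%N -> r1 k = r2 k.
Proof.
move=> dN dM NM [x Mx Nx] H1 H2.
apply: (epi_pranks (pull_pser P dN) (pull_pser P dM) (p := quotient_proj NM) _ _ H1 H2).
- move=> c; exists (coset_pi N (repr c)).
  by rewrite /= quotient_proj_coset coset_pi_repr.
(* A retraction of $G/M$ composed with the projection is a retraction of $G/N$. *)
- move=> i c _ Tc f rf; apply: (Tc (f \o quotient_proj NM)) => a /=.
  by rewrite quotient_proj_coset; exact: rf.
- exists (coset_pi N x); first by rewrite /= quotient_proj_coset; apply/coset_pi_eq1.
  by move/coset_pi_eq1.
Qed.

(* The tuples (r_i(G/N) - r_i(A))_i of the members of a chain are distinct
   elements of {0, ..., |X|}^n. *)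
Lemma prime_chain_bound k : has_prime_chain j k -> (k <= (size X).+1 ^ n)%N.
Proof.
move=> [p [pp plt]].
have : forall i, exists r', pranks n (pull S (const_quotient (p i))) r' /\
    forall l, (l < n)%N -> (r l <= r' l <= r l + size X)%N.
  by move=> i; have [r' ? ?] := quotient_pranks (pp i).2; exists r'.
move=> /choice[R HR].
pose t i : n.-tuple 'I_(size X).+1 := [tuple inord (R i l - r l) | l < n].
have tlt (i i' : 'I_k.+1) : (i < i')%N -> t i <> t i'.
  move=> lt tt; have [sub nsub] := plt i i' lt.
  have [||l ln [Rl _]] := quotient_lex (pp i).2 (pp i').2 _ _ (HR i).1 (HR i').1.
  - exact: sub.
  - apply: contrapT => H; apply: nsub => x px; apply: contrapT => npx.
    by apply: H; exists x.
  have /(congr1 val) := congr1 (fun t => tnth t (Ordinal ln)) tt.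
  rewrite !tnth_mktuple /=.
  have /andP[a1 b1] := (HR i).2 l ln; have /andP[a2 b2] := (HR i').2 l ln.
  by rewrite !inordK; lia.
have tinj : injective t.
  move=> i i' tt; case: (ltngtP i i') => [lt|lt|]; last exact: ord_inj.
    by case: (tlt _ _ lt tt).
  by case: (tlt _ _ lt (esym tt)).
(* The chain has $k+1$ members, hence even $k < (|X|+1)^n$. *)
by have := leq_card t tinj; rewrite card_tuple !card_ord => /ltnW.
Qed.

End QuotientRanks.

(** * Coordinate groups of algebraic sets *)

Section CoordinateGroups.
Local Open Scope group_scope.
Local Open Scope classical_set_scope.
Variables (A : groupType) (m : nat).
Implicit Types (Y : set (affine A m)) (s t : A[X_m]).

Lemma closed_zero_locus (T : set A[X_m]) : closed (zero_locus T).
Proof.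
rewrite -[zero_locus T]setCK; apply: open_closedC.
exists [set ~` zero_locus T]; last by rewrite bigcup_set1.
by move=> _ ->; exact: finI_from1.
Qed.

Lemma freeA_generators (C : set A[X_m]) :
  is_subgroup C -> (forall a, C (freeA_const m a)) ->
  (forall x, x \in [seq freeA_var A i | i <- enum 'I_m] -> C x) -> C = setT.
Proof.
move=> [C1 CF] CA CX.
have CV x : C x -> C x^-1 by move=> Cx; rewrite -div1g; exact: CF.
have CM x y : C x -> C y -> C (x * y).
  by move=> Cx Cy; rewrite -[y]invgK; apply: CF => //; exact: CV.
have clE (e f : gexpr A m) : gexpr_eq e f -> gexpr_class e = gexpr_class f.
  by move=> ef; apply/(@eqmodP _ (gexpr_equiv A m))/asboolP.
have clK (e : gexpr A m) : gexpr_eq (repr (gexpr_class e)) e.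
  have : gexpr_class (repr (gexpr_class e)) = gexpr_class e := reprK _.
  by move/(@eqmodP _ (gexpr_equiv A m))/asboolP.
apply/seteqP; split=> // x _; rewrite -[x]reprK.
elim: (repr x) => [a|i||e IHe f IHf|e IHe].
- exact: CA.
- by apply: CX; apply: map_f; rewrite mem_enum.
- exact: C1.
- rewrite [X in C X](_ : _ = gexpr_class e * gexpr_class f); first exact: CM.
  by apply/esym/clE/gexpr_mul; exact: clK.
- rewrite [X in C X](_ : _ = (gexpr_class e)^-1); first exact: CV.
  by apply/esym/clE/gexpr_inv; exact: clK.
Qed.

Section Point.
Variables (Y : set (affine A m)) (a : affine A m) (Ya : Y a).

Definition point_map of Y a : quotientGroup (vanishing Y) -> A :=
  fun c => peval a (repr c).

Lemma point_map_coset s : point_map Ya (coset_pi (vanishing Y) s) = peval a s.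
Proof.
have /coset_piP/(_ a Ya) := coset_pi_repr (coset_pi (vanishing Y) s).
rewrite /= /peval gmulfM gmulfV => /(canRL (mulVKg _)).
by rewrite mulg1 => ->.
Qed.

Lemma point_mapM : {morph point_map Ya : x y / x * y}.
Proof.
move=> c d; rewrite -(coset_pi_repr c) -(coset_pi_repr d) -coset_piM.
by rewrite !point_map_coset /peval gmulfM.
Qed.

HB.instance Definition _ :=
  monoid.isUMagmaMorphism.Build _ _ (point_map Ya) (morphM_monoid point_mapM).

End Point.

(** Splitting off one equation at a time writes [Y] as a union of two closed sets, one of which is
    then all of [Y]; nonemptiness excludes the empty list. *)
Lemma irreducible_cover Y (l : seq A[X_m]) : irreducible_algebraic Y ->
  (forall a, Y a -> exists2 s, s \in l & peval a s = 1) ->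
  exists2 s, s \in l & forall a, Y a -> peval a s = 1.
Proof.
move=> [_ [[a0 Ya0] clY irr]] cov.
pose Z (k : seq A[X_m]) : set (affine A m) := [set a | exists2 s, s \in k & peval a s = 1].
have clZ k : closed (Z k).
  elim: k => [|s k IH].
    rewrite (_ : Z [::] = set0); first exact: closed0.
    by apply/seteqP; split=> // a [s].
  rewrite (_ : Z (s :: k) = zero_locus [set s] `|` Z k).
    by apply: closedU => //; exact: closed_zero_locus.
  apply/seteqP; split=> [a [t]|a [sa|[t tk ta]]].
  - by rewrite inE => /predU1P[->|tk] ta; [left => _ -> | right; exists t].
  - by exists s; [exact: mem_head | exact: sa].
  - by exists t; rewrite // inE tk orbT.
elim: l cov => [|s l IH] cov; first by have [] := cov a0 Ya0.
have E : Y = (Y `&` zero_locus [set s]) `|` (Y `&` Z l).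
  apply/seteqP; split=> [a Ya|a [[]|[]]] //.
  have [t] := cov a Ya; rewrite inE => /predU1P[->|tl] ta.
    by left; split=> // _ ->.
  by right; split=> //; exists t.
have [||Ys|Yl] := irr _ _ _ _ E.
- by apply: closedI => //; exact: closed_zero_locus.
- exact: closedI.
- exists s; first exact: mem_head.
  by move=> a; rewrite -Ys => -[_]; apply.
- have [a|t tl tY] := IH; first by rewrite -Yl => -[].
  by exists t; rewrite // inE tl orbT.
Qed.

(** If every point of [Y] identified two distinct elements of [K], irreducibility would make one of
    the finitely many quotients vanish on [Y]. Evaluation at a remaining point is the required
    map. *)
Lemma discriminated_coord Y : irreducible_algebraic Y ->
  discriminated (@coord_const A m Y).
Proof.
move=> irrY K; pose N := vanishing Y.
pose l := [seq (repr p.1)^-1 * repr p.2 | p : quotientGroup N * quotientGroup N <-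
  [seq (c, d) | c <- enum_fset K, d <- enum_fset K] & p.1 != p.2].
have [H|] := pselect (forall a, Y a -> exists2 s, s \in l & peval a s = 1).
  have [s /mapP[[c d]]] := irreducible_cover irrY H.
  rewrite mem_filter /= => /andP[cd _] -> NI; case/eqP: cd.
  by rewrite -(coset_pi_repr c) -(coset_pi_repr d); apply/coset_piP.
move=> H; have [a Ya Ha] : exists2 a, Y a & forall s, s \in l -> peval a s <> 1.
  apply: contrapT => nH; apply: H => a Ya; apply: contrapT => na; apply: nH.
  by exists a => // s sl sa; apply: na; exists s.
exists (point_map Ya); split=> [b|c d cK dK].
  by rewrite /= point_map_coset /peval freeA_lift_const.
rewrite /= /point_map => e; apply: contrapT => /eqP cd.
apply: (Ha ((repr c)^-1 * repr d)).
  apply/mapP; exists (c, d) => //; rewrite mem_filter cd /=.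
  by apply/allpairsP; exists (c, d).
by rewrite /peval gmulfM gmulfV -[X in X^-1 * _]/(peval a _) e mulVg.
Qed.

Lemma vanishing_antimono (Y Z : set (affine A m)) : Y `<=` Z ->
  forall s, vanishing Z s -> vanishing Y s.
Proof. by move=> YZ s Zs a /YZ; exact: Zs. Qed.

Lemma vanishing_proper (Y Z : set (affine A m)) : algebraic Y -> ~ Z `<=` Y ->
  exists2 s, vanishing Y s & ~ vanishing Z s.
Proof.
move=> [T ->] nZY; apply: contrapT => H; apply: nZY => a Za s Ts.
have : vanishing Z s; last exact.
by apply: contrapT => nZs; apply: H; exists s => // b; exact.
Qed.

End CoordinateGroups.

(** The constants and the classes of the [m] variables generate the coordinate group. The set [Y] is
    arbitrary so that the bound also covers $A^m$. *)
Lemma prime_chain_coord (A : groupType) (n m : nat) (Y : set (affine A m)) k :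
  finitely_generated A -> rigid n A -> has_prime_chain (@coord_const A m Y) k ->
  (k <= m.+1 ^ n)%N.
Proof.
move=> fgA [s /principal_series_pser P]; have [r Sr] := fg_pranks fgA P.
have gen := @quotient_generators _ _ (freeA_const m) _ (@freeA_generators A m)
  (vanishing Y).
by move=> /(prime_chain_bound P Sr gen); rewrite size_map size_map size_enum_ord.
Qed.

Theorem theorem7p2 (A : groupType) (n m : nat)
    (fgA : finitely_generated A) (rigA : rigid n A) (m_ge1 : (1 <= m)%N) :
  (forall P S : set (affine A m),
     irreducible_algebraic P -> irreducible_algebraic S ->
     (P `<` S)%classic -> (alpha n P < alpha n S)%O) /\
  (forall S : set (affine A m), irreducible_algebraic S ->
     (Kdim_set S <= ((m.+1 ^ n)%N%:Z)%:E)%E) /\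
  (Kdim_set [set: affine A m] < +oo)%E.
Proof.
split; last first.
  split=> [S _|]; first by apply/Kdim_leP => k; exact: prime_chain_coord.
  by apply/Kdim_ltyP; exists (m.+1 ^ n)%N => k; exact: prime_chain_coord.
move=> Y Z irrY irrZ [YZ ZY].
have [s /principal_series_pser P] := rigA; have [r Sr] := fg_pranks fgA P.
have gen := @freeA_generators A m.
have dY : discriminated (const_quotient (freeA_const m) (vanishing Y)).
  exact: discriminated_coord irrY.
have dZ : discriminated (const_quotient (freeA_const m) (vanishing Z)).
  exact: discriminated_coord irrZ.
have [rY HY _] := quotient_pranks P Sr gen dY.
have [rZ HZ _] := quotient_pranks P Sr gen dZ.
(* A proper inclusion of [Y] in [Z] makes the ideal of [Z] properly smaller, so $\Gamma(Z)$ maps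
   onto $\Gamma(Y)$ with nontrivial kernel. *)
have [i lt [ltr eqr]] := quotient_lex P dZ dY (vanishing_antimono YZ)
  (vanishing_proper irrY.1 ZY) HZ HY.
have rkY := rigid_rankE (pull_pser P dY) HY.
have rkZ := rigid_rankE (pull_pser P dZ) HZ.
(* Both tuples are shifted by the same $r(A)$, which leaves the first difference in place. *)
apply/ltxi_tuplePlt; exists (Ordinal lt) => [k ki|]; rewrite !tnth_mktuple.
  by rewrite (rkY k) (rkZ k) eqr.
by rewrite (rkY (Ordinal lt)) (rkZ (Ordinal lt)) ltrD2r ltz_nat.
Qed.
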